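(* Let $n, r\ge 1$ and $0\le k\le n$, and let $T$ be a cube in $\mathbb{R}^n$. Then: (1) $$\dim\mathcal{S}_r\Lambda^k(T)=\sum_{d=k}^{\min(n,\lfloor r/2\rfloor+k)} 2^{n-d}\binom{n}{d}\binom{r-d+2k}{d}\binom{d}{k}.$$ (2) If $\mu\in\mathcal{S}_r\Lambda^k(T)$ and all of the degrees of freedom $$\mu\mapsto\int_f \operatorname{tr}_f\mu\wedge\nu,\qquad \nu\in\mathcal{P}_{r-2(d-k)}\Lambda^{d-k}(f),\quad f\in\Delta_d(T),\quad k\le d\le\min(n,\lfloor r/2\rfloor+k),$$ vanish, then $\mu\equiv 0$.
   Context: Polynomial forms. Let $\mathbb{N}_n=\{1,\dots,n\}$. For $\sigma=\{\sigma_1<\dots<\sigma_k\}\subset\mathbb{N}_n$ put $dx_\sigma=dx_{\sigma_1}\wedge\dots\wedge dx_{\sigma_k}$ and $\sigma^*=\mathbb{N}_n\setminus\sigma$. A $k$-form monomial is $m=x^\alpha\,dx_\sigma$ with $\alpha$ a multi-index and $\#\sigma=k$; set $\deg m=\sum_i\alpha_i$ and $\operatorname{ldeg} m=\#\{i\in\sigma^*: \alpha_i=1\}$. $\mathcal{P}_r\Lambda^k(\mathbb{R}^n)$ and $\mathcal{H}_r\Lambda^k(\mathbb{R}^n)$ are the spans of the $k$-form monomials of degree $\le r$, respectively $=r$. The linear degree $\operatorname{ldeg}$ of a polynomial form is the minimum of $\operatorname{ldeg} m$ over its monomials (the zero form counts as having linear degree at least $l$ for every $l$), and $\mathcal{H}_{r,l}\Lambda^k(\mathbb{R}^n)$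 is the space of $\omega\in\mathcal{H}_r\Lambda^k(\mathbb{R}^n)$ with $\operatorname{ldeg}\omega\ge l$. Spaces of $k$-forms with $k>n$ or $k<0$, and $\mathcal P_s\Lambda^k$ with $s<0$, are zero. Koszul differential: $\kappa\bigl(\sum_\sigma\omega_\sigma\,dx_\sigma\bigr)=\sum_\sigma\omega_\sigma\sum_{i=1}^k(-1)^{i+1}x_{\sigma_i}\,dx_{\sigma_1}\wedge\dots\wedge\widehat{dx_{\sigma_i}}\wedge\dots\wedge dx_{\sigma_k}$ (zero on $0$-forms). $d$ is the exterior derivative. Shape functions: $\mathcal{J}_r\Lambda^k(\mathbb{R}^n)=\sum_{l\ge1}\kappa\,\mathcal{H}_{r+l-1,l}\Lambda^{k+1}(\mathbb{R}^n)$ and, for $r\ge 1$, $0\le k\le n$, $\mathcal{S}_r\Lambda^k(\mathbb{R}^n)=\mathcal{P}_r\Lambda^k(\mathbb{R}^n)+\mathcal{J}_r\Lambda^k(\mathbb{R}^n)+d\mathcal{J}_{r+1}\Lambda^{k-1}(\mathbb{R}^n)$. $\mathcal{S}_r\Lambda^k(T)$ is the space of restrictions to $T$ of elements of $\mathcal{S}_r\Lambda^k(\mathbb{R}^n)$. Cubes: ''cube'' means a cube with edges parallel to the coordinate axes (more generally, $T$ may be a Cartesian product of $n$ closed intervals of positive finite length). $\Delta_d(T)$ is the set of $d$-dimensional faces of $T$; $\operatorname{tr}_f\mu$ is the pullback of $\mu$ to $f$ under the inclusion; $\mathcal{P}_s\Lambda^j(f)$ is the space of polynomial $j$-forms on $f$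 with coefficients of degree at most $s$ in the free coordinates of $f$. For $d=0$ the integral over a vertex is evaluation. *)

(* Defs.v *)
(* mpoly has to be imported before the analysis files: the notations of the two
   libraries clash in the other order. *)
From mathcomp Require Import all_boot all_order all_algebra.
From mathcomp Require Import mpoly.
From mathcomp Require Import boolp classical_sets functions set_interval reals.
From mathcomp Require Import measure lebesgue_measure lebesgue_integral.

Set Implicit Arguments.
Unset Strict Implicit.
Unset Printing Implicit Defensive.
Import Order.TTheory GRing.Theory Num.Theory.

Local Open Scope classical_set_scope.
Local Open Scope ring_scope.

(* [ext n A] is the exterior algebra on dx_0, ..., dx_(n-1) over A: the value
   at sigma is the coefficient of dx_sigma, the wedge of the dx_i, i \in sigma,
   in increasing order. *)
Definition ext (n : nat) (A : Type) := {ffun {set 'I_n} -> A}.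

Section Exterior.
Variables (n : nat) (A : comPzRingType).
Implicit Types (u v : ext n A) (s t : {set 'I_n}).

Definition dx_term (c : A) s : ext n A := [ffun t => if t == s then c else 0].

(* dx_s /\ dx_t = (-1)^inversions(s, t) dx_(s U t) for disjoint s, t. *)
Definition inversions s t : nat :=
  #|[set p : 'I_n * 'I_n | [&& p.1 \in s, p.2 \in t & (p.2 < p.1)%N]]%SET|.

Definition wedge u v : ext n A :=
  \sum_(s : {set 'I_n}) \sum_(t : {set 'I_n} | [disjoint s & t])
    dx_term ((-1) ^+ inversions s t * (u s * v t)) (s :|: t).

End Exterior.

Section PolynomialForms.
Variables (R : realType) (n : nat).

Definition pform := ext n {mpoly R[n]}.

Implicit Types (w : pform) (s : {set 'I_n}) (m : 'X_{1..n}).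

(* If i is the p-th smallest element of s (p >= 1), then
   #|[set j in s | j < i]| = p - 1, so the sign below is (-1)^(p+1). *)
Definition koszul w : pform :=
  \sum_(s : {set 'I_n}) \sum_(i in s)
    dx_term ((-1) ^+ #|[set j in s | (j < i)%N]| * ('X_i * w s)) (s :\ i).

Definition ext_d w : pform :=
  \sum_(i < n) wedge (dx_term 1 [set i]) [ffun s => (w s)^`M(i)].

Definition ldeg m s : nat := #|[set i | (i \notin s) && (m i == 1%N)]%SET|.

(* The span of the form monomials x^m dx_s with P m s. *)
Definition monomial_span (P : 'X_{1..n} -> {set 'I_n} -> Prop) : set pform :=
  [set w | forall s m, m \in msupp (w s) -> P m s].

(* The form degree k is an integer, so that the spaces of k-forms with k < 0
   are zero. *)
Definition PL (r : nat) (k : int) : set pform :=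
  monomial_span (fun m s => #|s|%:Z = k /\ (mdeg m <= r)%N).

Definition HL (r : nat) (k : int) : set pform :=
  monomial_span (fun m s => #|s|%:Z = k /\ mdeg m = r).

(* [ldeg_ge l w] is "ldeg w >= l", where ldeg w is the minimum over the
   monomials of w; it holds for w = 0. *)
Definition ldeg_ge (l : nat) w : Prop :=
  forall s m, m \in msupp (w s) -> (l <= ldeg m s)%N.

Definition HlL (r l : nat) (k : int) : set pform :=
  [set w | HL r k w /\ ldeg_ge l w].

Definition JL (r : nat) (k : int) : set pform :=
  [set w | exists (N : nat) (eta : nat -> pform),
     (forall l, (1 <= l <= N)%N -> HlL (r + l - 1) l (k + 1) (eta l)) /\
     w = \sum_(1 <= l < N.+1) koszul (eta l)].

Definition SL (r : nat) (k : int) : set pform :=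
  [set w | exists p q q' : pform,
     [/\ PL r k p, JL r k q, JL r.+1 (k - 1) q' & w = p + q + ext_d q']].

(* R^o is R as a module over itself, so that fields form an R-module. *)
Definition form_field := 'rV[R]_n -> ext n R^o.

Definition eval_form w : form_field := fun x => [ffun s => (w s).@[x ord0]].

Definition box (a b : 'rV[R]_n) : set 'rV[R]_n :=
  [set x | forall i, a ord0 i <= x ord0 i <= b ord0 i].

(* The restriction to T is represented by its extension by zero. *)
Definition restrict_form (T : set 'rV[R]_n) w : form_field :=
  patch (fun=> [ffun=> 0]) T (eval_form w).

Definition SL_on (T : set 'rV[R]_n) (r : nat) (k : int) : set form_field :=
  [set restrict_form T w | w in SL r k].

End PolynomialForms.

Definition has_dim (R : pzRingType) (V : lmodType R) (W : set V) (N : nat) :=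
  exists e : 'I_N -> V,
    (forall c : 'I_N -> R, \sum_i c i *: e i = 0 -> forall i, c i = 0) /\
    W = [set \sum_i c i *: e i | c in [set: 'I_N -> R]].

(* On the face of box a b encoded by f, x_i is free in [a_i, b_i] for i in
   [face_free f], and fixed otherwise, to b_i or a_i according to
   [face_side f i].  The sides of the free directions are irrelevant, so a face
   may have several codes. *)
Record face (n : nat) := Face {
  face_free : {set 'I_n};
  face_side : {ffun 'I_n -> bool} }.

Definition face_dim (n : nat) (f : face n) : nat := #|face_free f|.

Section Faces.
Variables (R : realType) (n : nat) (a b : 'rV[R]_n) (f : face n).

(* Pullback to the face: dx_i restricts to 0 for i not free.  Only the values
   of mu on the face are used in [face_integral] below. *)
Definition face_trace (mu : form_field R n) : form_field R n :=
  fun x => [ffun s : {set 'I_n} => if s \subset face_free f then mu x s else 0].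

Definition PL_face (s : nat) (j : int) : set (pform R n) :=
  [set nu | PL s j nu /\
     monomial_span (fun m (t : {set 'I_n}) => t \subset face_free f /\
       forall i, i \notin face_free f -> m i = 0%N) nu].

Definition face_corner : 'rV[R]_n :=
  \row_i (if face_side f i then b ord0 i else a ord0 i).

(* Integrate successively over the coordinates in l, the others being those
   of x. *)
Fixpoint iterated_integral (l : seq 'I_n) (g : 'rV[R]_n -> R) (x : 'rV[R]_n)
    : R :=
  if l is i :: l' then
    \int[lebesgue_measure]_(t in `[a ord0 i, b ord0 i])
      iterated_integral l' g (\row_j (if j == i then t else x ord0 j))
  else g x.

Definition face_integral (eta : form_field R n) : R :=
  iterated_integral (enum (face_free f)) (fun x => eta x (face_free f))
    face_corner.

Definition dof (nu : pform R n) (mu : form_field R n) : R :=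
  face_integral (fun x => wedge (face_trace mu x) (eval_form nu x)).

End Faces.

(* Main.v *)
Require Import Defs.
From mathcomp Require Import all_boot all_order all_algebra.
From mathcomp Require Import ssrcomplements mpoly.
From mathcomp Require Import boolp classical_sets functions reals.
From mathcomp Require Import topology normedtype derive measure.
From mathcomp Require Import lebesgue_measure lebesgue_integral ftc.
From mathcomp Require Import ring zify.
From mathcomp.boot Require Import fintype finset.

Set Implicit Arguments.
Unset Strict Implicit.
Unset Printing Implicit Defensive.
Import Order.TTheory GRing.Theory Num.Theory.

Local Open Scope ring_scope.

(* Give x^m dx_s the multidegree b = m + 1_s.  The operators koszul and ext_d
   preserve b, and on the component of multidegree b they act as the contraction
   with the indicator of {b_i >= 1} and as the wedge product with b; their
   anticommutator is the total degree |b|.  With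
     wt b s = sum_(b_i >= 2) b_i + #{i in s : b_i = 1} = deg + #s - ldeg
   a k-form w is in S_r iff koszul w and koszul (ext_d w) have terms of weight
   <= r + k only.

   Dimension: the contraction is exact on the terms of bounded weight, the
   homotopy being the wedge product with some dx_i, b_i >= 2 (on the multidegrees
   with all b_i <= 1 there is no constraint).  So S_r is isomorphic to the span of
   the k-form monomials of weight <= r + k, which are counted directly.

   Unisolvence: by induction on the dimension of f, the trace of mu on f is divisible
   by (x_j - a_j)(x_j - b_j) in the dx_s component for all free j not in s.  If the
   trace is closed, the weight condition forces its degree to be <= r, so that the
   cofactor of these quadratic factors may be used as a test function, and the
   trace vanishes.  In general, by parts, the exterior derivative of the trace satisfies
   the same hypotheses with r - 1 and k + 1, so that the trace is closed. *)

(** * The exterior algebra *)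

(** The weight makes one bound serve everywhere. A (k+1)-form term of degree r + l - 1 and linear
    degree at least l has weight at most r + k, whatever l is, and passing from (r, k) to (r + 1, k
    - 1) keeps r + k; so the sum over l and both J-spaces in S_r give a single condition. The
    obstacle is that this condition does not bound the degree of w by r. Moreover the trace of
    [koszul e] is no longer a Koszul image: directions that become constant leave a remainder. Its
    weight is lower by one, exactly what [ext_d] may add, so the conditions on [koszul w] and
    [koszul (ext_d w)] survive traces; this is why unisolvence uses them instead of the
    decomposition of S_r. For the dimension, let h be the wedge product with dx_i, b_i >= 2, which
    keeps the weight. In v = koszul h v + h koszul v the last h is replaced by [ext_d], which on
    Koszul images also inverts [koszul], up to the factor |b|; the result lies in S_r. The cube
    enters unisolvence through a sign: the product of the (x_j - a_j)(x_j - b_j) has constant sign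
    on it. *)

Section Contraction.
Variables (R : numFieldType) (n : nat).
Implicit Types (i j : 'I_n) (s t : {set 'I_n}) (u v : 'I_n -> R).
Implicit Types (w : {ffun {set 'I_n} -> R}).

(** The sign of moving [dx_i] to its place past the factors of [dx_s] with smaller index. *)
Definition sgn_at i s : R := (-1) ^+ #|[set j in s | (j < i)%N]|.

Lemma sgn_atK i s x : sgn_at i s * (sgn_at i s * x) = x.
Proof. by rewrite mulrA /sgn_at -exprD addnn -signr_odd odd_double expr0 mul1r. Qed.

Lemma sgn_atU1 i j s : j \notin s -> sgn_at i (j |: s) = (-1) ^+ (j < i)%N * sgn_at i s.
Proof.
move=> js; rewrite /sgn_at -exprD; congr (_ ^+ _).
have [ji|ij] := boolP (j < i)%N.
  rewrite -[RHS](_ : #|j |: [set k in s | (k < i)%N]| = _); last first.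
    by rewrite cardsU1 !inE (negPf js).
  by apply: eq_card => k; rewrite !inE; case: eqVneq => [->|]//=; rewrite ji.
apply: eq_card => k; rewrite !inE; case: eqVneq => [->|]//=.
by rewrite (negPf ij) andbF.
Qed.

Lemma sgn_atD1 i j s : j \in s -> sgn_at i (s :\ j) = (-1) ^+ (j < i)%N * sgn_at i s.
Proof.
move=> js; rewrite -{2}(setD1K js) sgn_atU1 ?setD11// mulrA -exprD addnn.
by rewrite -signr_odd odd_double mul1r.
Qed.

Lemma sgn_at_swap i j : i != j -> (-1) ^+ (j < i)%N = - (-1) ^+ (i < j)%N :> R.
Proof.
by rewrite -val_eqE /= => /negPf ij; case: ltngtP ij; rewrite ?opprK// => ->.
Qed.

(** Contraction with the vector [u], read coefficientwise; [eps_ext] is the left wedge product with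
    the covector [v]. *)
Definition iota_ext u w : {ffun {set 'I_n} -> R} :=
  [ffun s : {set 'I_n} => \sum_(i | i \notin s) sgn_at i s * (u i * w (i |: s))].

Definition eps_ext v w : {ffun {set 'I_n} -> R} :=
  [ffun s : {set 'I_n} => \sum_(i in s) sgn_at i s * (v i * w (s :\ i))].

(** Exchanging the two indices turns the sum into its opposite, and 2 is invertible. Both squares
    below vanish for this reason. *)
Lemma sum_antisym (P : pred 'I_n) (Q : rel 'I_n) (F : 'I_n -> 'I_n -> R) :
  (forall i j, P i && Q i j = P j && Q j i) ->
  (forall i j, P i -> Q i j -> F i j = - F j i) ->
  \sum_(i | P i) \sum_(j | Q i j) F i j = 0.
Proof.
move=> PQ FN; set S := LHS.
have SN : S = - S.
  rewrite {1}/S (exchange_big_dep predT)//= /S -sumrN [RHS]big_mkcond/=.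
  apply: eq_bigr => j _; rewrite -sumrN.
  case: ifP => Pj; last first.
    by rewrite big_pred0// => i; rewrite PQ Pj.
  apply: eq_big => [i|i]; first by rewrite PQ Pj.
  by case/andP => Pi Qij; rewrite FN.
have : S *+ 2 = 0 by rewrite mulr2n {1}SN addNr.
by move/eqP; rewrite mulrn_eq0 /= => /eqP.
Qed.

Lemma iota_iota u w : iota_ext u (iota_ext u w) = 0.
Proof.
apply/ffunP => s; rewrite !ffunE.
under eq_bigr do rewrite ffunE mulrA mulr_sumr.
apply: (@sum_antisym _ (fun i j => j \notin i |: s)) => [i j|i j is_].
  by rewrite !inE !negb_or eq_sym; do 2 case: (_ \in s); case: (_ == _).
rewrite !inE negb_or => /andP[ji js].
rewrite setUCA sgn_atU1 // (sgn_atU1 i)// (sgn_at_swap ji); ring.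
Qed.

Lemma eps_eps v w : eps_ext v (eps_ext v w) = 0.
Proof.
apply/ffunP => s; rewrite !ffunE.
under eq_bigr do rewrite ffunE mulrA mulr_sumr.
apply: (@sum_antisym _ (fun i j => j \in s :\ i)) => [i j|i j is_].
  by rewrite !inE eq_sym; do 2 case: (_ \in s); case: (_ == _).
rewrite !inE => /andP[ji js].
rewrite setDDl setUC -setDDl sgn_atD1 // (sgn_atD1 i)// (sgn_at_swap ji); ring.
Qed.

(** The terms i = j give the pairing of [u] and [v], split between i outside and inside [s]; the
    terms with distinct i, j cancel by the sign of exchanging dx_i and dx_j. *)
Lemma iota_eps u v w s :
  iota_ext u (eps_ext v w) s + eps_ext v (iota_ext u w) s
    = (\sum_i u i * v i) * w s.
Proof.
rewrite !ffunE.
have -> : \sum_(i | i \notin s) sgn_at i s * (u i * eps_ext v w (i |: s)) =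
  \sum_(i | i \notin s) (u i * v i * w s) +
  \sum_(i | i \notin s) \sum_(j in s)
     sgn_at i s * sgn_at j (i |: s) * (u i * v j * w ((i |: s) :\ j)).
  rewrite -big_split; apply: eq_bigr => i is_; rewrite ffunE big_setU1//=.
  rewrite setU1K // mulrDr mulrDr; congr (_ + _).
    rewrite sgn_atU1 // ltnn mul1r -[RHS](sgn_atK i s); ring.
  by rewrite !mulr_sumr; apply: eq_bigr => j js; ring.
have -> : \sum_(j in s) sgn_at j s * (v j * iota_ext u w (s :\ j)) =
  \sum_(j in s) (u j * v j * w s) +
  \sum_(j in s) \sum_(i | i \notin s)
     sgn_at j s * sgn_at i (s :\ j) * (u i * v j * w ((i |: s) :\ j)).
  rewrite -big_split; apply: eq_bigr => j js; rewrite ffunE (bigD1 j)//=; last first.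
    by rewrite !inE eqxx.
  rewrite setD1K // mulrDr mulrDr; congr (_ + _).
    rewrite sgn_atD1 // ltnn mul1r -[RHS](sgn_atK j s); ring.
  rewrite !mulr_sumr; apply: eq_big => [i|i].
    by rewrite !inE negb_and negbK; case: (eqVneq i j) => [->|];
      rewrite ?andbF ?andbT//= js.
  rewrite !inE => /andP[_ ij]; rewrite (_ : _ |: _ = (i |: s) :\ j); last first.
    by apply/setP => x; rewrite !inE; case: (eqVneq x i) => [->|]//=; rewrite ij.
  ring.
rewrite [X in _ + (_ + X)]exchange_big/= addrACA -big_split /=.
rewrite [X in _ + X]big1 ?addr0 => [|i is_].
  by rewrite mulr_suml [RHS](bigID (fun i => i \in s)) addrC.
rewrite -big_split big1//= => j js.
have ij : i != j by apply: contraNneq is_ => ->.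
rewrite sgn_atU1 // sgn_atD1 // (sgn_at_swap ij); ring.
Qed.

Lemma iota_extD u w1 w2 : iota_ext u (w1 + w2) = iota_ext u w1 + iota_ext u w2.
Proof.
apply/ffunP => s; rewrite !ffunE -big_split; apply: eq_bigr => i _.
by rewrite ffunE !mulrDr.
Qed.

Lemma eps_extD u w1 w2 : eps_ext u (w1 + w2) = eps_ext u w1 + eps_ext u w2.
Proof.
apply/ffunP => s; rewrite !ffunE -big_split; apply: eq_bigr => i _.
by rewrite ffunE !mulrDr.
Qed.

End Contraction.

(** * Components of given multidegree *)

Lemma wedgeE (n : nat) (A : comPzRingType) (u v : ext n A) (t : {set 'I_n}) :
  wedge u v t = \sum_(s : {set 'I_n} | s \subset t)
    (-1) ^+ inversions s (t :\: s) * (u s * v (t :\: s)).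
Proof.
rewrite /wedge sum_ffunE [RHS]big_mkcond; apply: eq_bigr => s _.
rewrite sum_ffunE; case: ifP => st; last first.
  rewrite big1// => t' _; rewrite ffunE; case: eqP => // tE.
  by move: st; rewrite tE subsetUl.
rewrite (bigD1 (t :\: s)) /=; last first.
  by rewrite -setI_eq0; apply/eqP/setP => x; rewrite !inE; case: (x \in s).
rewrite ffunE -{1}(setIidPr st) setID eqxx.
rewrite big1 ?addr0// => t' /andP[dst t'n]; rewrite ffunE; case: eqP => // tE.
move: t'n; rewrite tE setDUl setDv set0U.
by rewrite (setDidPl _) ?eqxx// disjoint_sym.
Qed.

Section Forms.
Variables (R : realType) (n : nat).
Implicit Types (w : pform R n) (s t : {set 'I_n}) (i j : 'I_n).
Implicit Types (a b m : 'X_{1..n}) (v : {ffun {set 'I_n} -> R}).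

Lemma koszulE w t :
  koszul w t = \sum_(i | i \notin t) sgn_at R i t *: ('X_i * w (i |: t)).
Proof.
rewrite /koszul sum_ffunE.
under eq_bigr do rewrite sum_ffunE.
rewrite (exchange_big_dep predT)//= [RHS]big_mkcond; apply: eq_bigr => i _.
case: ifP => [it|/negbFE it]; last first.
  rewrite big1// => s _; rewrite ffunE; case: eqP => // tE.
  by move: it; rewrite tE setD11.
rewrite (bigD1 (i |: t)) ?setU11//= ffunE setU1K // eqxx.
rewrite big1 ?addr0; last first.
  move=> s /andP[si sn]; rewrite ffunE; case: eqP => // tE.
  by move: sn; rewrite tE setD1K ?eqxx.
rewrite /sgn_at -[in RHS]signr_odd scaler_sign -signr_odd mulr_sign.
suff -> : [set j in i |: t | (j < i)%N] = [set j in t | (j < i)%N] by [].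
by apply/setP => j; rewrite !inE; case: eqVneq => [->|]//=; rewrite ltnn andbF.
Qed.

Lemma ext_dE w t :
  ext_d w t = \sum_(i in t) sgn_at R i t *: (w (t :\ i))^`M(i).
Proof.
rewrite /ext_d sum_ffunE [RHS]big_mkcond; apply: eq_bigr => i _.
rewrite wedgeE; case: ifP => it; last first.
  rewrite big1// => s st; rewrite ffunE; case: eqP => [sE|];
    last by rewrite mul0r mulr0.
  by move: st; rewrite sE sub1set it.
rewrite (bigD1 [set i]) ?sub1set//= big1 ?addr0; last first.
  by move=> s /andP[_ /negPf si]; rewrite ffunE si mul0r mulr0.
rewrite !ffunE eqxx mul1r /sgn_at -[in RHS]signr_odd scaler_sign -signr_odd mulr_sign.
suff -> : inversions [set i] (t :\ i) = #|[set j in t | (j < i)%N]| by [].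
rewrite /inversions -(card_imset _ (can_inj (fun j =>
  erefl : (fun p : 'I_n * 'I_n => p.2) (i, j) = j))).
apply: eq_card => -[x y]; rewrite !inE /=; apply/idP/imsetP => /=.
  case/and3P => /eqP -> /andP[yi yt] ylt; exists y => //.
  by rewrite inE yt.
case=> j; rewrite inE => /andP[jt ji] [-> ->]; rewrite eqxx jt ji andbT /=.
by rewrite andbT; apply: contraTneq ji => ->; rewrite ltnn.
Qed.

Definition mnm_set s : 'X_{1..n} := [multinom (i \in s : nat) | i < n].

Definition bsupp b : {set 'I_n} := [set i | (0 < b i)%N].

(** The coefficients of the terms x^(b - 1_s) dx_s. Subtraction of multi-indices is truncated, so
    the sets [s] outside the support of [b], which carry no term of multidegree [b], are excluded by
    hand. *)
Definition component b w : {ffun {set 'I_n} -> R} :=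
  [ffun s : {set 'I_n} => if s \subset bsupp b then (w s)@_(b - mnm_set s) else 0].

Lemma mcoeffXiM i (p : {mpoly R[n]}) m :
  ('X_i * p)@_m = if (0 < m i)%N then p@_(m - U_(i)) else 0.
Proof.
rewrite mulrC; case: ifP => mi.
  have {1}-> : m = (U_(i) + (m - U_(i)))%MM; last by rewrite mcoeffMX.
  apply/mnmP => j; rewrite mnmDE mnmBE mnm1E; case: eqVneq => [<-|]//=; lia.
apply/eqP; rewrite mcoeff_eq0 (perm_mem (msuppMX _ _)).
apply/mapP => -[m' _ mE]; move: mi; rewrite mE mnmDE mnm1E eqxx; lia.
Qed.

Lemma mnm_setE s i : mnm_set s i = (i \in s).
Proof. by rewrite mnmE. Qed.

Lemma bsuppU1 b i t : (i |: t \subset bsupp b) = (0 < b i)%N && (t \subset bsupp b).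
Proof. by rewrite subUset sub1set inE. Qed.

(** Trading dx_i for x_i leaves m + 1_s unchanged; the indicator discards the directions in which no
    term of multidegree [b] contains dx_i. *)
Lemma component_koszul b w :
  component b (koszul w) = iota_ext (fun i => (0 < b i)%N%:R) (component b w).
Proof.
apply/ffunP => t; rewrite !ffunE koszulE raddf_sum /=.
case: ifP => tb; last first.
  rewrite big1// => i it; rewrite ffunE bsuppU1 tb andbF; ring.
apply: eq_bigr => i it; rewrite mcoeffZ mcoeffXiM ffunE bsuppU1 tb andbT.
rewrite mnmBE mnm_setE (negPf it) subn0; case: ifP => bi; last by rewrite mul0r.
rewrite mul1r; congr (_ * _@__); apply/mnmP => j.
rewrite !mnmBE !mnm_setE mnm1E !inE eq_sym.
by case: eqVneq => [->|ij] /=; rewrite ?(negPf it) ?subn0.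
Qed.

(** Differentiation produces the exponent of x_i, which is b_i because dx_i is still absent from the
    term being differentiated. *)
Lemma component_ext_d b w :
  component b (ext_d w) = eps_ext (fun i => (b i)%:R) (component b w).
Proof.
apply/ffunP => t; rewrite !ffunE ext_dE raddf_sum /=.
case: ifP => tb; last first.
  rewrite big1// => i it; rewrite ffunE; case: ifP => tib; last by ring.
  have := bsuppU1 b i (t :\ i); rewrite setD1K // tb tib andbT => /esym.
  by case: (b i) => // _; ring.
apply: eq_bigr => i it; rewrite mcoeffZ mcoeff_deriv ffunE.
have := bsuppU1 b i (t :\ i); rewrite setD1K // tb => /esym/andP[bi ->].
have -> : (b - mnm_set t + U_(i) = b - mnm_set (t :\ i))%MM.
  apply/mnmP => j; rewrite mnmDE !mnmBE !mnm_setE mnm1E !inE eq_sym.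
  by case: eqVneq => [->|ij] /=; rewrite ?it ?addn0 ?subn0 ?subnK//; move: bi;
    rewrite inE.
rewrite -[_ *+ _]mulr_natl; congr (_ * (_%:R * _)).
by rewrite mnmBE mnm_setE it /=; lia.
Qed.

Lemma componentP w1 w2 : (forall b, component b w1 = component b w2) -> w1 = w2.
Proof.
move=> w12; apply/ffunP => s; apply/mpolyP => m.
have /ffunP/(_ s) := w12 (m + mnm_set s)%MM; rewrite !ffunE.
have -> : s \subset bsupp (m + mnm_set s)%MM.
  by apply/subsetP => i si; rewrite inE mnmDE mnm_setE si; lia.
suff -> : (m + mnm_set s - mnm_set s = m)%MM by [].
exact: addmK.
Qed.

Lemma component_coef w s m : (w s)@_m = component (m + mnm_set s) w s.
Proof.
rewrite !ffunE addmK.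
suff -> : s \subset bsupp (m + mnm_set s)%MM by [].
by apply/subsetP => i si; rewrite inE mnmDE mnm_setE si; lia.
Qed.

Lemma componentD b w1 w2 : component b (w1 + w2) = component b w1 + component b w2.
Proof.
by apply/ffunP => s; rewrite !ffunE; case: ifP => _; rewrite ?addr0// mcoeffD.
Qed.

End Forms.

Opaque koszul ext_d.

Section ExtSupport.
Variables (R : numFieldType) (n : nat).
Implicit Types (i : 'I_n) (s : {set 'I_n}) (u v : 'I_n -> R).
Implicit Types (w : {ffun {set 'I_n} -> R}).

Lemma iota_ext_neq0 u w s : iota_ext u w s != 0 ->
  exists i, [/\ i \notin s, u i != 0 & w (i |: s) != 0].
Proof.
rewrite ffunE => /eqP N0.
have [i /and3P[]|N] := pickP (fun i => [&& i \notin s, u i != 0 & w (i |: s) != 0]).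
  by exists i.
case: N0; apply: big1 => i si; have := N i; rewrite si /= => /nandP[]/negPn/eqP->; ring.
Qed.

Lemma eps_ext_neq0 v w s : eps_ext v w s != 0 ->
  exists i, [/\ i \in s, v i != 0 & w (s :\ i) != 0].
Proof.
rewrite ffunE => /eqP N0.
have [i /and3P[]|N] := pickP (fun i => [&& i \in s, v i != 0 & w (s :\ i) != 0]).
  by exists i.
case: N0; apply: big1 => i si; have := N i; rewrite si /= => /nandP[]/negPn/eqP->; ring.
Qed.

End ExtSupport.

(** * The weight of a term *)

Definition wti (c : nat) (e : bool) : nat :=
  if (1 < c)%N then c else e && (c == 1%N).

Definition wt (n : nat) (b : 'X_{1..n}) (s : {set 'I_n}) : nat :=
  \sum_i wti (b i) (i \in s).

Section Weight.
Variable n : nat.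
Implicit Types (b : 'X_{1..n}) (s t : {set 'I_n}) (i : 'I_n).

Lemma wtS b s t : s \subset t -> (wt b s <= wt b t)%N.
Proof.
move=> /fintype.subsetP st; apply: leq_sum => i _; rewrite /wti; case: ifP => // _.
by case: (boolP (i \in s)) => // /st ->.
Qed.

Lemma wtU1 b s i : (wt b (i |: s) <= (wt b s).+1)%N.
Proof.
rewrite /wt (bigD1 i)//= [in X in (_ <= X)%N](bigD1 i)//= -addSn leq_add//.
  rewrite /wti; case: ifP => // _; case: (_ && _) => //.
by apply/eq_leq/eq_bigr => j ji; rewrite !inE (negPf ji).
Qed.

(** A direction with b_i >= 2 counts b_i whether or not it lies in [s]. Hence wedging with such a
    dx_i does not change the weight. *)
Lemma wtU1_big b s i : (1 < b i)%N -> wt b (i |: s) = wt b s.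
Proof.
move=> bi; apply: eq_bigr => j _; rewrite /wti !inE.
by case: (eqVneq j i) => [->|//]; rewrite bi.
Qed.

Lemma wt_mdeg b s :
  (wt b s + #|[set i | (i \notin s) && (b i == 1%N)]|)%N = mdeg b.
Proof.
rewrite mdegE /wt -sum1_card [X in (_ + X)%N]big_mkcond -big_split;
  apply: eq_bigr => i _.
rewrite inE /wti; case: (b i) => [|[|c]] /=; case: (i \in s) => //=; lia.
Qed.

Lemma mdeg_mnm_set s : mdeg (mnm_set s) = #|s|.
Proof.
rewrite mdegE -sum1_card [RHS]big_mkcond; apply: eq_bigr => i _.
by rewrite mnm_setE; case: (i \in s).
Qed.

(** Off [s] the multidegree is the exponent itself, so what the weight omits from the total degree
    is precisely what [ldeg] counts. *)
Lemma wt_ldeg (m : 'X_{1..n}) s :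
  (wt (m + mnm_set s) s + ldeg m s)%N = (mdeg m + #|s|)%N.
Proof.
rewrite -mdeg_mnm_set -mdegD -(wt_mdeg (m + mnm_set s)%MM s); congr (_ + _)%N.
apply: eq_card => i; rewrite !inE mnmDE mnm_setE; case: (i \in s) => //=.
by rewrite addn0.
Qed.

End Weight.

(** * Classes of forms given by conditions on their terms *)

Section FormClasses.
Variables (R : realType) (n : nat).
Implicit Types (w : pform R n) (s t : {set 'I_n}) (i j : 'I_n).
Implicit Types (a b m : 'X_{1..n}) (v : {ffun {set 'I_n} -> R}).

Lemma component_msupp w s m : m \in msupp (w s) -> component (m + mnm_set s) w s != 0.
Proof. by rewrite mcoeff_msupp component_coef. Qed.

Lemma component_neq0 b w s : component b w s != 0 ->
  [/\ s \subset bsupp b, (b - mnm_set s)%MM \in msupp (w s) &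
      b = (b - mnm_set s + mnm_set s)%MM].
Proof.
rewrite ffunE; case: ifP => [sb N0|]; last by rewrite eqxx.
split => //; first by rewrite mcoeff_msupp.
apply/mnmP => i; rewrite mnmDE mnmBE mnm_setE; case: (boolP (i \in s)) => [|_] /=.
  by move/(fintype.subsetP sb); rewrite inE; lia.
by rewrite subn0 addn0.
Qed.

Definition spanned (Q : 'X_{1..n} -> {set 'I_n} -> Prop) w :=
  forall b s, component b w s != 0 -> Q b s.

Lemma spanned_msupp (Q : 'X_{1..n} -> {set 'I_n} -> Prop) w :
  (forall s m, m \in msupp (w s) -> Q (m + mnm_set s)%MM s) <-> spanned Q w.
Proof.
split=> [H b s /component_neq0[_ /H Qb ->]//|H s m /component_msupp]; exact: H.
Qed.

Lemma spannedD (Q : 'X_{1..n} -> {set 'I_n} -> Prop) w1 w2 :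
  spanned Q w1 -> spanned Q w2 -> spanned Q (w1 + w2).
Proof.
move=> H1 H2 b s; rewrite componentD ffunE.
by have [->|/H1//] := eqVneq (component b w1 s) 0; rewrite add0r => /H2.
Qed.

Lemma component0 b : component b (0 : pform R n) = 0.
Proof. by apply/ffunP => s; rewrite !ffunE mcoeff0; case: ifP. Qed.

Lemma spanned0 (Q : 'X_{1..n} -> {set 'I_n} -> Prop) : spanned Q 0.
Proof. by move=> b s; rewrite component0 ffunE eqxx. Qed.

Lemma spanned_sum (Q : 'X_{1..n} -> {set 'I_n} -> Prop) (I : Type) (l : seq I)
    (P : pred I) (F : I -> pform R n) :
  (forall x, P x -> spanned Q (F x)) -> spanned Q (\sum_(x <- l | P x) F x).
Proof. by move=> H; apply: big_ind => //; [exact: spanned0|exact: spannedD]. Qed.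

Definition wt_lt T := spanned (fun b s => wt b s < T)%N.
Definition fdeg k := spanned (fun b s => #|s| = k).

Lemma wt_ltW T T' w : (T <= T')%N -> wt_lt T w -> wt_lt T' w.
Proof. by move=> TT H b s /H wb; exact: leq_trans wb TT. Qed.

Lemma koszulD w1 w2 : koszul (w1 + w2) = koszul w1 + koszul w2.
Proof.
apply: componentP => b; rewrite (componentD b (koszul w1) (koszul w2)).
rewrite (component_koszul b (w1 + w2)) (component_koszul b w1) (component_koszul b w2).
by rewrite (componentD b w1 w2) iota_extD.
Qed.

Lemma ext_dD w1 w2 : ext_d (w1 + w2) = ext_d w1 + ext_d w2.
Proof.
apply: componentP => b; apply: (etrans (component_ext_d b (w1 + w2))).
apply: (etrans (congr1 (eps_ext _) (componentD b w1 w2))).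
apply: (etrans (eps_extD _ _ _)).
apply: (etrans _ (esym (componentD b (ext_d w1) (ext_d w2)))).
exact (congr2 +%R (esym (component_ext_d b w1)) (esym (component_ext_d b w2))).
Qed.

Lemma koszul0 : koszul (0 : pform R n) = 0.
Proof. by have := koszulD 0 0; rewrite addr0 -[LHS]addr0 => /addrI/esym. Qed.

Lemma ext_d0 : ext_d (0 : pform R n) = 0.
Proof. by have := ext_dD 0 0; rewrite addr0 -[LHS]addr0 => /addrI/esym. Qed.

Lemma koszulK w : koszul (koszul w) = 0.
Proof. by apply: componentP => b; rewrite !component_koszul iota_iota component0. Qed.

Lemma ext_dK w : ext_d (ext_d w) = 0.
Proof. by apply: componentP => b; rewrite !component_ext_d eps_eps component0. Qed.

Lemma iota_eps_mdeg b v s :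
  iota_ext (fun i => (0 < b i)%N%:R) (eps_ext (fun i => (b i)%:R) v) s
  + eps_ext (fun i => (b i)%:R) (iota_ext (fun i => (0 < b i)%N%:R) v) s
   = (mdeg b)%:R * v s :> R.
Proof.
rewrite iota_eps mdegE natr_sum; congr (_ * _); apply: eq_bigr => i _.
by case: (b i) => [|c]; rewrite /= ?mulr0// mul1r.
Qed.

Lemma wt_lt_koszul T w : wt_lt T w -> wt_lt T (koszul w).
Proof.
move=> H b s; rewrite component_koszul => /iota_ext_neq0[i [_ _ /H wb]].
by apply: leq_ltn_trans wb; rewrite wtS ?subsetUr.
Qed.

Lemma wt_lt_ext_d T w : wt_lt T w -> wt_lt T.+1 (ext_d w).
Proof.
move=> H b s; rewrite component_ext_d => /eps_ext_neq0[i [si _ /H wb]].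
by rewrite ltnS -(setD1K si) (leq_trans (wtU1 _ _ _)).
Qed.

Lemma fdeg_koszul k w : fdeg k.+1 w -> fdeg k (koszul w).
Proof.
move=> H b s; rewrite component_koszul => /iota_ext_neq0[i [si _ /H]].
by rewrite cardsU1 si => -[].
Qed.

Lemma fdeg_ext_d k w : fdeg k w -> fdeg k.+1 (ext_d w).
Proof.
move=> H b s; rewrite component_ext_d => /eps_ext_neq0[i [si _ /H]].
by rewrite (cardsD1 i s) si => ->.
Qed.

(** Since [koszul] squares to zero, the anticommutator makes this operator |b| times [koszul] on
    each component; the possible increase of weight by [ext_d] is thus undone. *)
Lemma wt_lt_koszul_ext_d_koszul T w :
  wt_lt T w -> wt_lt T (koszul (ext_d (koszul w))).
Proof.
move=> /wt_lt_koszul H b s Nz; apply: H; apply: contraNneq Nz => wz.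
rewrite component_koszul component_ext_d component_koszul.
have := iota_eps_mdeg b (iota_ext (fun i : 'I_n => (0 < b i)%N%:R) (component b w)) s.
rewrite iota_iota -component_koszul wz mulr0.
have -> : eps_ext (fun i : 'I_n => (b i)%:R) 0 s = 0 :> R.
  by rewrite ffunE big1// => i _; rewrite ffunE; ring.
by rewrite addr0 => ->.
Qed.

(** The weight bound is free of l: (r + l - 1) + (k + 1) - l = r + k. So the sum over l fits under
    one [koszul]. *)
Lemma JL_koszul (r : nat) (k : int) (q : pform R n) : JL r k q ->
  exists2 e, q = koszul e &
    spanned (fun b s => #|s|%:Z = k + 1 /\ (wt b s)%:Z <= r%:Z + k) e.
Proof.
case=> N [eta [He ->]]; exists (\sum_(1 <= l < N.+1) eta l).
  by rewrite (big_morph _ koszulD koszul0).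
rewrite big_nat; apply: spanned_sum => l /andP[l1 lN].
case: (He l) => [|Hh Hl]; first by rewrite l1.
apply/spanned_msupp => s m ms; have [sk mE] := Hh s m ms; have lm := Hl s m ms.
split=> //; have := wt_ldeg m s; move: sk mE lm l1; lia.
Qed.

Lemma SL_gen r k w : SL r k%:Z w -> exists p e f : pform R n,
  [/\ spanned (fun b s => #|s| = k /\ mdeg b <= r + k)%N p,
      fdeg k.+1 e /\ wt_lt (r + k).+1 e,
      fdeg k f /\ wt_lt (r + k).+1 f &
      w = p + koszul e + ext_d (koszul f)].
Proof.
case=> p [q [q' [Pp /JL_koszul[e -> He] /JL_koszul[f -> Hf] ->]]].
exists p, e, f; split => //.
- apply/spanned_msupp => s m /Pp[sk mr]; rewrite mdegD mdeg_mnm_set; split; lia.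
- by split=> b s /He; lia.
- by split=> b s /Hf; lia.
Qed.

End FormClasses.

(** * Traces *)

Section Substitution.
Variables (R : realType) (n : nat).
Implicit Types (F A B : {set 'I_n}) (x y : 'I_n -> R) (p q : {mpoly R[n]}).
Implicit Types (m : 'X_{1..n}) (i j : 'I_n).

(** The coordinates outside [F] are frozen at [x], but the result stays a polynomial in all n
    variables, so that traces on different faces live in one type. *)
Definition subst F x p : {mpoly R[n]} :=
  p \mPo [tuple (if i \in F then 'X_i else (x i)%:MP) | i < n].

Definition mnm_restr F m : 'X_{1..n} := [multinom if i \in F then m i else 0%N | i < n].

Lemma eq_scaleX (c c' : R) m m' :
  c = c' -> m = m' -> c *: 'X_[m] = c' *: 'X_[m'] :> {mpoly R[n]}.
Proof. by move=> -> ->. Qed.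

Lemma substX F x m :
  subst F x 'X_[m] = (\prod_(i | i \notin F) x i ^+ m i) *: 'X_[mnm_restr F m].
Proof.
rewrite /subst comp_mpolyX (bigID (mem F))/= mulrC -mul_mpolyC; congr (_ * _).
  rewrite rmorph_prod; apply: eq_bigr => i /negPf Fi.
  by rewrite tnth_mktuple Fi rmorphXn.
rewrite [RHS]mpolyXE_id [RHS](bigID (mem F))/= [X in _ = _ * X]big1 ?mulr1.
  by apply: eq_bigr => i Fi; rewrite tnth_mktuple mnmE Fi.
by move=> i /negPf Fi; rewrite mnmE Fi.
Qed.

Lemma subst_linear F x c p q : subst F x (c *: p + q) = c *: subst F x p + subst F x q.
Proof. by rewrite /subst comp_mpolyD comp_mpolyZ. Qed.

Lemma subst0 F x : subst F x 0 = 0. Proof. exact: comp_mpoly0. Qed.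
Lemma substD F x p q : subst F x (p + q) = subst F x p + subst F x q.
Proof. exact: comp_mpolyD. Qed.
Lemma substZ F x c p : subst F x (c *: p) = c *: subst F x p.
Proof. exact: comp_mpolyZ. Qed.
Lemma substM F x p q : subst F x (p * q) = subst F x p * subst F x q.
Proof. exact: rmorphM. Qed.
Lemma substC F x c : subst F x c%:MP = c%:MP. Proof. exact: comp_mpolyC. Qed.

Lemma subst_sum F x (I : Type) (l : seq I) (P : pred I) (G : I -> {mpoly R[n]}) :
  subst F x (\sum_(k <- l | P k) G k) = \sum_(k <- l | P k) subst F x (G k).
Proof. exact: (big_morph _ (substD F x) (subst0 F x)). Qed.

Lemma subst_prod F x (I : Type) (l : seq I) (P : pred I) (G : I -> {mpoly R[n]}) :
  subst F x (\prod_(k <- l | P k) G k) = \prod_(k <- l | P k) subst F x (G k).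
Proof. exact: rmorph_prod. Qed.

Lemma subst_XsubC_id F x i c : i \in F -> subst F x ('X_i - c%:MP) = 'X_i - c%:MP.
Proof.
move=> Fi; rewrite /subst comp_mpolyB comp_mpolyC comp_mpolyXU -tnth_nth tnth_mktuple.
by rewrite Fi.
Qed.

Lemma subst_Xi F x i : subst F x 'X_i = if i \in F then 'X_i else (x i)%:MP.
Proof. by rewrite /subst comp_mpolyXU -tnth_nth tnth_mktuple. Qed.

Lemma subst_msupp F x p m : m \in msupp (subst F x p) ->
  exists2 m', m' \in msupp p & m = mnm_restr F m'.
Proof.
elim/mpolyind: p m => [|c m0 p m0p c0 IH] m; first by rewrite subst0 msupp0.
rewrite subst_linear substX scalerA => /msuppD_le;
  rewrite mem_cat => /orP[|/IH[m' m'p ->]].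
  move=> /msuppZ_le; rewrite msuppX inE => /eqP ->; exists m0 => //.
  by rewrite mcoeff_msupp mcoeffD mcoeffZ mcoeffX eqxx mulr1 (memN_msupp_eq0 m0p) addr0.
exists m' => //; rewrite mcoeff_msupp mcoeffD mcoeffZ mcoeffX.
case: (eqVneq m0 m') => [m0E|]; first by rewrite m0E m'p in m0p.
by rewrite mulr0 add0r -mcoeff_msupp.
Qed.

Lemma subst_subst A B x p : subst A x (subst B x p) = subst (A :&: B) x p.
Proof.
elim/mpolyind: p => [|c m p _ _ IH]; first by rewrite !subst0.
rewrite [subst B _ _]subst_linear [LHS]subst_linear [RHS]subst_linear IH.
suff -> : subst A x (subst B x 'X_[m]) = subst (A :&: B) x 'X_[m] by [].
rewrite substX substZ [subst A x _]substX substX scalerA; apply: eq_scaleX.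
  rewrite [X in X * _]big_mkcond [X in _ * X]big_mkcond [RHS]big_mkcond -big_split.
  apply: eq_bigr => i _ /=; rewrite inE mnmE.
  by case: (i \in A); case: (i \in B); rewrite ?mulr1 ?mul1r.
by apply/mnmP => i; rewrite !mnmE inE; case: (i \in A).
Qed.

Lemma eq_subst F x y p : (forall i, i \notin F -> x i = y i) ->
  subst F x p = subst F y p.
Proof.
move=> xy; rewrite /subst; congr (_ \mPo _); apply: eq_from_tnth => i.
by rewrite !tnth_mktuple; case: ifPn => // /xy ->.
Qed.

Lemma substT x p : subst [set: 'I_n] x p = p.
Proof.
rewrite -[RHS](@comp_mpoly_id n R); congr (_ \mPo _); apply: eq_from_tnth => i.
by rewrite !tnth_mktuple inE.
Qed.

Lemma subst_mderiv F x i p : i \in F ->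
  subst F x (p^`M(i)) = (subst F x p)^`M(i).
Proof.
move=> Fi; elim/mpolyind: p => [|c m p _ _ IH]; first by rewrite mderiv0 subst0 mderiv0.
rewrite mderivD mderivZ [LHS]subst_linear [subst F x
  (_ + p)]subst_linear [RHS]mderivD [in RHS]mderivZ IH.
suff -> : subst F x ('X_[m])^`M(i) = (subst F x 'X_[m])^`M(i) by [].
rewrite mderivX substZ !substX mderivZ mderivX !scalerA mulrC mnmE Fi.
apply: eq_scaleX; first congr (_ * _).
  apply: eq_bigr => j Fj; rewrite mnmBE mnm1E; case: eqVneq => [ij|];
    last by rewrite subn0.
  by rewrite -ij Fi in Fj.
apply/mnmP => j; rewrite !(mnmE, mnmBE, mnm1E); case: ifPn => //.
Qed.

Lemma subst_mderiv0 F x i p : i \notin F -> (subst F x p)^`M(i) = 0.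
Proof.
move=> /negPf Fi; elim/mpolyind: p => [|c m p _ _ IH]; first by rewrite subst0 mderiv0.
rewrite subst_linear mderivD IH addr0 mderivZ substX mderivZ mderivX mnmE Fi.
by rewrite scale0r !scaler0.
Qed.

Lemma meval_subst F x y p :
  (subst F x p).@[y] = p.@[fun i => if i \in F then y i else x i].
Proof.
rewrite /subst comp_mpoly_meval; apply: meval_eq => i.
by rewrite tnth_mktuple; case: ifP => _; rewrite ?mevalXU ?mevalC.
Qed.

End Substitution.


Opaque subst.

Section Trace.
Variables (R : realType) (n : nat).
Implicit Types (F : {set 'I_n}) (x : 'I_n -> R) (w e : pform R n).

Definition ptrace F x w : pform R n :=
  [ffun s : {set 'I_n} => if s \subset F then subst F x (w s) else 0].

(** The part of the contraction along frozen directions: x_i has become a constant, while dx_i has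
    already disappeared from the trace of [w]. *)
Definition ptrace_rem F x w : pform R n :=
  [ffun s : {set 'I_n} => if s \subset F then
     \sum_(i | i \notin F) sgn_at R i s *: (x i *: subst F x (w (i |: s))) else 0].

Lemma ptraceD F x w1 w2 : ptrace F x (w1 + w2) = ptrace F x w1 + ptrace F x w2.
Proof.
by apply/ffunP => s; rewrite !ffunE; case: ifP => _; rewrite ?addr0// substD.
Qed.

Lemma ptrace_idem F x w : ptrace F x (ptrace F x w) = ptrace F x w.
Proof.
apply/ffunP => s; rewrite !ffunE; case: ifPn => // sF.
by rewrite sF subst_subst setIid.
Qed.

Lemma ptrace_koszul F x e :
  ptrace F x (koszul e) = koszul (ptrace F x e) + ptrace_rem F x e.
Proof.
apply/ffunP => s; rewrite [LHS]ffunE [RHS]ffunE !koszulE [ptrace_rem _ _ _ _]ffunE.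
case: ifPn => sF; last first.
  rewrite big1 ?addr0// => i _; rewrite ffunE ifF ?mulr0 ?scaler0//.
  by apply: contraNF sF => /(fintype.subset_trans (subsetUr _ _)).
rewrite subst_sum (bigID (mem F))/= [in RHS](bigID (mem F))/= -addrA; congr (_ + _).
  apply: eq_bigr => i /andP[_ Fi]; rewrite substZ substM subst_Xi Fi ffunE.
  by rewrite subUset sub1set Fi sF.
rewrite [X in _ = X + _]big1 ?add0r; last first.
  move=> i /andP[_ /negPf Fi]; rewrite ffunE.
  by rewrite subUset sub1set Fi mulr0 scaler0.
apply: eq_big => [i|i /andP[_ /negPf Fi]].
  by case: (boolP (i \in s)) => // /(fintype.subsetP sF) ->.
by rewrite substZ substM subst_Xi Fi mul_mpolyC.
Qed.

Lemma ptrace_ext_d F x e : ptrace F x (ext_d e) = ext_d (ptrace F x e).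
Proof.
apply/ffunP => s; rewrite [LHS]ffunE [RHS]ext_dE; case: ifPn => sF;
  first rewrite ext_dE.
  rewrite subst_sum; apply: eq_bigr => i si; rewrite substZ subst_mderiv; last first.
    exact: (fintype.subsetP sF).
  by rewrite ffunE (fintype.subset_trans (subsetDl _ _) sF).
rewrite big1// => i si; rewrite ffunE; case: ifPn => siF;
  last by rewrite mderiv0 scaler0.
rewrite subst_mderiv0 ?scaler0//; apply: contraNN sF => Fi.
by rewrite -(setD1K si) subUset sub1set Fi.
Qed.

Lemma wti0 (c : bool) : wti 0 c = 0%N. Proof. by case: c. Qed.

Lemma wt_mnm_restr F (m : 'X_{1..n}) (s : {set 'I_n}) : s \subset F ->
  (wt (mnm_restr F m + mnm_set s) s <= wt (m + mnm_set s) s)%N.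
Proof.
move=> /fintype.subsetP sF; apply: leq_sum => i _; rewrite !mnmDE mnm_setE mnmE.
by case: (boolP (i \in F)) => // /(contra (sF i))/negPf ->; rewrite addn0 wti0.
Qed.

(** Before the restriction i lies in the set and has multidegree at least 1, hence positive weight;
    afterwards it has weight 0. *)
Lemma wt_mnm_restr_U1 F (m : 'X_{1..n}) (s : {set 'I_n}) i : s \subset F ->
  i \notin F ->
  (wt (mnm_restr F m + mnm_set s) s < wt (m + mnm_set (i |: s)) (i |: s))%N.
Proof.
move=> /fintype.subsetP sF iF; rewrite /wt (bigD1 i)//= [X in
  (_ < X)%N](bigD1 i)//= -addSn.
apply: leq_add.
  have /negPf is_ : i \notin s by apply: contra iF => /sF.
  rewrite !mnmDE !mnm_setE mnmE (negPf iF) is_ wti0 !inE eqxx /= addn1 /wti.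
  by case: (m i).
apply: leq_sum => j /negPf ji; rewrite !mnmDE !mnm_setE mnmE !inE ji /=.
by case: (boolP (j \in F)) => // /(contra (sF j))/negPf ->; rewrite addn0 wti0.
Qed.

Lemma wt_lt_ptrace F x T e : wt_lt T e -> wt_lt T (ptrace F x e).
Proof.
move=> H; apply/spanned_msupp => s m; rewrite ffunE; case: ifPn => [sF|];
  last by rewrite msupp0.
move=> /subst_msupp[m' /component_msupp/H wm ->].
exact: leq_ltn_trans (wt_mnm_restr _ sF) wm.
Qed.

Lemma wt_lt_ptrace_rem F x T e : wt_lt T.+1 e -> wt_lt T (ptrace_rem F x e).
Proof.
move=> H; apply/spanned_msupp => s m; rewrite ffunE; case: ifPn => [sF|];
  last by rewrite msupp0.
rewrite mcoeff_msupp raddf_sum /= => N0.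
have [i /andP[iF N]] : exists i, (i \notin F) && ((subst F x (e (i |: s)))@_m != 0).
  apply/existsP; apply: contraNT N0; rewrite negb_exists => /forallP N0.
  rewrite big1// => i iF; have := N0 i; rewrite iF negbK /= => /eqP N.
  by rewrite !mcoeffZ N !mulr0.
move: N; rewrite -mcoeff_msupp => /subst_msupp[m' /component_msupp/H wm ->].
exact: leq_trans (wt_mnm_restr_U1 _ sF iF) wm.
Qed.

Lemma fdeg_ptrace F x k e : fdeg k e -> fdeg k (ptrace F x e).
Proof.
move=> H; apply/spanned_msupp => s m; rewrite ffunE; case: ifPn => [sF|];
  last by rewrite msupp0.
by move=> /subst_msupp[m' /component_msupp/H].
Qed.

(* For k-forms, [shape_class (r + k).+1] is equivalent to [SL r k]. *)
Definition shape_class T w := wt_lt T (koszul w) /\ wt_lt T (koszul (ext_d w)).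

Lemma AclassD T w1 w2 : shape_class T w1 -> shape_class T w2 -> shape_class T (w1 + w2).
Proof.
move=> [a1 b1] [a2 b2]; split; first by rewrite (koszulD w1 w2); exact (spannedD a1 a2).
by rewrite (ext_dD w1 w2) (koszulD (ext_d w1) (ext_d w2)); exact (spannedD b1 b2).
Qed.

Lemma shape_class_ext_d T w : wt_lt T (koszul (ext_d w)) -> shape_class T (ext_d w).
Proof.
by move=> H; split; [exact H|rewrite (ext_dK w) koszul0; exact: spanned0].
Qed.

(** The trace of [koszul g] is [koszul] of a trace plus a remainder of weight lower by one. Applying
    [ext_d] to the remainder costs at most this one, so the bound is the original one. *)
Lemma shape_class_ptrace_SL F x r k w : SL r k%:Z w ->
  shape_class (r + k).+1 (ptrace F x w).
Proof.
case/SL_gen=> p [e [f [Pp [_ We] [_ Wf] ->]]].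
have Pp' : spanned (fun b s => mdeg b < (r + k).+1)%N (ptrace F x p).
  apply/spanned_msupp => s m; rewrite ffunE; case: ifPn => [sF|];
    last by rewrite msupp0.
  move=> /subst_msupp[m' /component_msupp/Pp[_ mr] ->]; rewrite ltnS;
    apply: leq_trans mr.
  rewrite !mdegD leq_add2r !mdegE; apply: leq_sum => i _; rewrite mnmE.
  by case: ifP.
(* The weight never exceeds |b|, and neither operator changes [b]. *)
have Pk (q : pform R n) : spanned (fun b s => mdeg b < (r + k).+1)%N q ->
    shape_class (r + k).+1 q.
  move=> Hq; split=> b s.
    rewrite component_koszul => /iota_ext_neq0[i [_ _ /Hq hq]].
    by apply: leq_ltn_trans hq; rewrite -(wt_mdeg b s) leq_addr.
  rewrite component_koszul => /iota_ext_neq0[i [_ _ +]].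
  rewrite component_ext_d => /eps_ext_neq0[j [_ _ /Hq hq]].
  by apply: leq_ltn_trans hq; rewrite -(wt_mdeg b s) leq_addr.
have K (g : pform R n) : wt_lt (r + k).+1 g ->
    shape_class (r + k).+1 (ptrace F x (koszul g)).
  move=> Wg; rewrite ptrace_koszul; apply: AclassD; split.
  - by rewrite koszulK; exact: spanned0.
  - by apply: wt_lt_koszul_ext_d_koszul; exact: wt_lt_ptrace.
  - by apply: wt_lt_koszul; apply: (wt_ltW (leqnSn _)); exact: wt_lt_ptrace_rem.
  - by apply: wt_lt_koszul; apply: wt_lt_ext_d; exact: wt_lt_ptrace_rem.
rewrite ptraceD ptraceD ptrace_ext_d; apply: AclassD.
  by apply: AclassD; [exact: Pk|exact: K].
by apply: shape_class_ext_d; have [] := K _ Wf.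
Qed.

End Trace.

(** * Closed forms vanishing on the boundary *)

Section ClosedTop.
Variables (R : realType) (n : nat).
Implicit Types (s t F : {set 'I_n}) (i j : 'I_n).
Implicit Types (b : 'X_{1..n}) (v : {ffun {set 'I_n} -> R}).

Lemma iota_ext_eq0 (u : 'I_n -> R) v s :
  (forall i, i \notin s -> u i != 0 -> v (i |: s) = 0) -> iota_ext u v s = 0.
Proof.
move=> H; apply/eqP/negPn/negP => /iota_ext_neq0[i [si ui]].
by rewrite H ?eqxx.
Qed.

Lemma eps_ext_eq0 (u : 'I_n -> R) v s :
  (forall i, i \in s -> u i != 0 -> v (s :\ i) = 0) -> eps_ext u v s = 0.
Proof.
move=> H; apply/eqP/negPn/negP => /eps_ext_neq0[i [si ui]].
by rewrite H ?eqxx.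
Qed.

(* Let [B1] be the set of i with b_i = 1.  All terms of v contain dx_i for i in
   [B1], so modulo the span of the other terms only the contraction and the
   wedge product with the directions b_i >= 2 act on v.  Both kill v, hence so
   does their anticommutator, which is multiplication by the sum of the b_i >= 2. *)
Lemma closed_top_eq0 F b T k v :
  (forall i, i \notin F -> b i = 0%N) ->
  (forall s, v s != 0 ->
     [/\ s \subset F, s \subset bsupp b, #|s| = k &
         forall i, i \in F -> i \notin s -> (1 < b i)%N]) ->
  (forall s, iota_ext (fun i => (0 < b i)%N%:R) v s != 0 -> (wt b s < T)%N) ->
  eps_ext (fun i => (b i)%:R) v = 0 ->
  (T <= mdeg b)%N -> (k < T)%N -> v = 0.
Proof.
move=> bF vP Hi He Tb kT; apply/ffunP => s0; rewrite [RHS]ffunE.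
apply/eqP/negPn/negP => s0N.
have B1 s i : v s != 0 -> b i = 1%N -> i \in s.
  move=> /vP[_ _ _ H] bi; apply/negPn/negP => si.
  have iF : i \in F by apply/negPn/negP => /bF; rewrite bi.
  by have := H i iF si; rewrite bi.
pose u1 i : R := (1 < b i)%N%:R.
pose b1 i : R := if (1 < b i)%N then (b i)%:R else 0.
have I0 : iota_ext u1 v = 0.
  apply/ffunP => t; rewrite [RHS]ffunE.
  (* If [t] contains every i with b_i = 1, its weight is |b| >= T and [Hi] applies. Otherwise j |: t
     with b_j >= 2 still misses such an i, and [v] vanishes there. *)
  have [Bt|] := boolP [forall i, (b i == 1%N) ==> (i \in t)].
    have -> : iota_ext u1 v t = iota_ext (fun i => (0 < b i)%N%:R) v t.
      rewrite !ffunE; apply: eq_bigr => i it; rewrite /u1.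
      have := forallP Bt i; rewrite (negPf it) implybF; case: (b i) => [|[|c]] //.
    apply/eqP/negPn/negP => /Hi; rewrite ltnNge -(_ : mdeg b = wt b t) ?Tb//.
    rewrite -(wt_mdeg b t) -[RHS]addn0; congr (_ + _)%N; apply/eqP.
    rewrite cards_eq0 -subset0; apply/fintype.subsetP => i; rewrite inE => /andP[it bi].
    by have := forallP Bt i; rewrite bi (negPf it).
  rewrite negb_forall => /existsP[i]; rewrite negb_imply => /andP[/eqP bi it].
  apply: iota_ext_eq0 => j jt; rewrite /u1; case: (ltnP 1 (b j)) => [bj _|];
    last by rewrite eqxx.
  apply/eqP/negPn/negP => /B1 /(_ bi); rewrite !inE (negPf it) orbF => /eqP ij.
  by rewrite -ij bi in bj.
have E0 : eps_ext b1 v = 0.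
  apply/ffunP => t; rewrite [RHS]ffunE.
  have [Bt|] := boolP [forall i, (b i == 1%N) ==> (i \in t)].
    have -> : eps_ext b1 v t = eps_ext (fun i => (b i)%:R) v t.
      rewrite !ffunE; apply: eq_bigr => i it; rewrite /b1.
      case: (ltnP 1 (b i)) => // bi; have [->|N] := eqVneq (v (t :\ i)) 0.
        by rewrite !mulr0.
      have [bi1|bi1] := eqVneq (b i) 1%N; first by have := B1 _ _ N bi1;
        rewrite !inE eqxx.
      by have -> : b i = 0%N by lia.
    by rewrite He ffunE.
  rewrite negb_forall => /existsP[i]; rewrite negb_imply => /andP[/eqP bi it].
  apply: eps_ext_eq0 => j jt _.
  by apply/eqP/negPn/negP => /B1 /(_ bi); rewrite !inE (negPf it) andbF.
(* The anticommutator forces all b_i <= 1. Then [b] is at most the indicator of [s0], so |b| <= k <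
   T, a contradiction. *)
have := iota_eps u1 b1 v s0.
rewrite I0 E0 iota_ext_eq0; last by move=> i _ _; rewrite ffunE.
rewrite eps_ext_eq0; last by move=> i _ _; rewrite ffunE.
rewrite addr0 => /esym/eqP; rewrite mulf_eq0 (negPf s0N) orbF.
have -> : \sum_i u1 i * b1 i = (\sum_(i | (1 < b i)%N) b i)%:R.
  rewrite natr_sum [RHS]big_mkcond; apply: eq_bigr => i _; rewrite /u1 /b1.
  by case: (1 < b i)%N; rewrite ?mul1r ?mul0r.
rewrite pnatr_eq0 sum_nat_eq0 => /forallP bN.
have bi1 i : (b i <= 1)%N.
  by case: (leqP (b i) 1) => // bi; have := bN i; rewrite bi => /eqP; lia.
have [s0F _ s0k H] := vP _ s0N.
suff : (mdeg b <= k)%N by lia.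
rewrite -s0k -mdeg_mnm_set !mdegE; apply: leq_sum => i _; rewrite mnm_setE.
case: (boolP (i \in s0)) => [//|is0]; rewrite leqn0; apply/eqP.
case: (boolP (i \in F)) => [iF|/bF//]; have := H i iF is0; have := bi1 i; lia.
Qed.

End ClosedTop.

(** * Linear factors and terms of top degree *)

Section Division.
Variables (R : realType) (n : nat).
Implicit Types (p q g : {mpoly R[n]}) (m : 'X_{1..n}) (i j : 'I_n) (c : R).

Definition vanish j c p := subst [set~ j] (fun=> c) p = 0.

(** By linearity, p minus its restriction to x_j = c is divisible by x_j - c, because x_j^e - c^e
    is. *)
Lemma vanish_div j c p : vanish j c p -> exists q, p = ('X_j - c%:MP) * q.
Proof.
rewrite /vanish => p0.
suff [q pq] : exists q, p - subst [set~ j] (fun=> c) p = ('X_j - c%:MP) * q.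
  by exists q; rewrite -pq p0 subr0.
elim/mpolyind: (p) => [|d m r _ _ [q IH]]; first by exists 0;
  rewrite subst0 subr0 mulr0.
have [q' Hq'] : exists q', 'X_[m] - subst [set~ j] (fun=> c) 'X_[m] =
  ('X_j - c%:MP) * q'.
  rewrite substX (big_pred1 j); last by move=> i; rewrite !inE negbK.
  have -> : 'X_[R, m] = 'X_j ^+ m j * 'X_[mnm_restr [set~ j] m].
    rewrite mpolyXn -mpolyXD; congr 'X_[_]; apply/mnmP => i.
    rewrite mnmDE mulmnE mnm1E mnmE !inE eq_sym.
    by case: (eqVneq i j) => [->|]; rewrite /= ?mul1n ?addn0.
  rewrite -mul_mpolyC -mulrBl rmorphXn subrXX -mulrA.
  by eexists.
exists (d%:MP * q' + q); rewrite subst_linear opprD addrACA -scalerBr Hq' IH.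
by rewrite mulrDr -mul_mpolyC mulrCA.
Qed.

Lemma XsubC_neq0 j c : 'X_j - c%:MP != 0 :> {mpoly R[n]}.
Proof.
apply/eqP => /(congr1 (fun p => p@_U_(j)));
  rewrite mcoeffB mcoeffX eqxx mcoeffC mnm1_eq0.
by rewrite mulr0 subr0 mcoeff0; apply/eqP; rewrite oner_eq0.
Qed.

Lemma vanishM j c p q : vanish j c (p * q) -> subst [set~ j] (fun=> c) p != 0 ->
  vanish j c q.
Proof. by rewrite /vanish substM => /eqP; rewrite mulf_eq0 => /orP[->//|/eqP]. Qed.

Lemma subst_XsubC j c i d : (i, d) != (j, c) ->
  subst [set~ j] (fun=> c) ('X_i - d%:MP) != 0 :> {mpoly R[n]}.
Proof.
move=> id_jc; rewrite -scaleN1r addrC subst_linear substC subst_Xi !inE scaleN1r addrC.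
case: (eqVneq i j) id_jc => [->|_ _]; last exact: XsubC_neq0.
by rewrite xpair_eqE eqxx /= -mpolyCB mpolyC_eq0 subr_eq0 eq_sym.
Qed.

(** Substituting x_j = c does not annihilate the factor of another pair, and polynomials form a
    domain, so the remaining zeros pass to the cofactor. *)
Lemma vanish_div_all (L : seq ('I_n * R)) p : uniq L ->
  (forall z, z \in L -> vanish z.1 z.2 p) ->
  exists q, p = (\prod_(z <- L) ('X_z.1 - z.2%:MP)) * q.
Proof.
elim: L p => [|[j c] L IH] p /=; first by exists p; rewrite big_nil mul1r.
move=> /andP[jcL uL] H; have [q pq] := vanish_div (H (j, c) (mem_head _ _)).
have [z zL|q' qq'] := IH q uL; last first.
  by exists q'; rewrite big_cons -mulrA -qq'.
have zjc : (j, c) != z by apply: contraNneq jcL => ->.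
apply: (@vanishM _ _ ('X_j - c%:MP)); first by rewrite -pq; apply: H;
  rewrite inE zL orbT.
by apply: subst_XsubC; rewrite -surjective_pairing.
Qed.

Lemma msize_XsubC j c : msize ('X_j - c%:MP : {mpoly R[n]}) = 2%N.
Proof.
apply/eqP; rewrite eqn_leq; apply/andP; split.
  apply: leq_trans (msizeD_le _ _) _; rewrite msizeX mdeg1 msizeN msizeC.
  by case: (c != 0).
have : U_(j)%MM \in msupp ('X_j - c%:MP : {mpoly R[n]}).
  by rewrite mcoeff_msupp mcoeffB mcoeffX eqxx mcoeffC mnm1_eq0 mulr0 subr0 oner_eq0.
by move/msize_mdeg_lt; rewrite mdeg1.
Qed.

Lemma msize_XsubCM j c q : q != 0 -> msize (('X_j - c%:MP) * q) = (msize q).+1.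
Proof. by move=> q0; rewrite msizeM ?XsubC_neq0// msize_XsubC. Qed.

Lemma msize_prod_XsubC (L : seq ('I_n * R)) q : q != 0 ->
  msize ((\prod_(z <- L) ('X_z.1 - z.2%:MP)) * q) = (size L + msize q)%N.
Proof.
move=> q0; elim: L => [|z L IH]; first by rewrite big_nil mul1r.
rewrite big_cons -mulrA msize_XsubCM ?IH//.
rewrite mulf_neq0// prodf_seq_neq0; apply/allP => y _ /=; exact: XsubC_neq0.
Qed.

(** A term of top degree in (x_j - c) g can only come from x_j g. *)
Lemma mcoeff_top_XsubC j c p g m : p = ('X_j - c%:MP) * g -> m \in msupp p ->
  (msize p <= (mdeg m).+1)%N ->
  [/\ (0 < m j)%N, (m - U_(j))%MM \in msupp g & (msize g <= mdeg m)%N].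
Proof.
have [->|g0] := eqVneq g 0; first by rewrite mulr0 => ->; rewrite msupp0.
move=> pE mp; rewrite pE msize_XsubCM // ltnS => gm; move: mp.
rewrite pE mulrBl mcoeff_msupp mcoeffB mcoeffXiM mcoeffCM (memN_msupp_eq0
  (msize_mdeg_ge gm)).
by case: ifP => [mj|]; rewrite mulr0 subr0 ?eqxx// -mcoeff_msupp.
Qed.

(** Distinct zeros give two linear factors, each contributing one x_j to every term of top
    degree. *)
Lemma vanish_top j c d p m : c != d -> vanish j c p -> vanish j d p ->
  m \in msupp p -> (msize p <= (mdeg m).+1)%N -> (1 < m j)%N.
Proof.
move=> cd pc pd mp mm; have [g pE] := vanish_div pc.
have gd : vanish j d g.
  apply: (@vanishM _ _ ('X_j - c%:MP)); first by rewrite -pE.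
  by apply: subst_XsubC; rewrite xpair_eqE eqxx.
have [mj mg gm] := mcoeff_top_XsubC pE mp mm; have [h gE] := vanish_div gd.
have := mcoeff_top_XsubC gE mg; rewrite mnmBE mnm1E eqxx => -[|+ _ _]; last lia.
have -> : ((mdeg (m - U_(j))%MM).+1 = mdeg m)%N => //.
rewrite -[in RHS](_ : (m - U_(j) + U_(j))%MM = m) ?mdegD ?mdeg1 ?addn1//.
apply: submK; apply/mnm_lepP => i; rewrite mnm1E; case: eqVneq => [<-|]//=; lia.
Qed.

End Division.

(** * Moments and integrals *)

Section Moment.
Variables (R : realType) (n : nat).
Implicit Types (p q : {mpoly R[n]}) (m : 'X_{1..n}) (i j : 'I_n) (c d : R).
Implicit Types (u : 'I_n -> nat -> R).

(* Evaluations, iterated integrals and coefficients are all of this form. *)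
Definition moment u p : R := \sum_(m <- msupp p) p@_m * \prod_i u i (m i).

Lemma momentwE k u p : (msize p <= k)%N ->
  moment u p = \sum_(m : 'X_{1..n < k}) p@_m * \prod_i u i (m i).
Proof.
move=> pk; pose I : subFinType _ := 'X_{1..n < k}.
rewrite /moment (big_mksub I) //=; first last.
- by move=> m /msize_mdeg_lt /leq_trans; apply.
- by rewrite msupp_uniq.
by rewrite big_rmcond //= => m; move/memN_msupp_eq0 ->; rewrite mul0r.
Qed.

Lemma momentD u p q : moment u (p + q) = moment u p + moment u q.
Proof.
pose k := maxn (msize (p + q)) (maxn (msize p) (msize q)).
rewrite !(@momentwE k) ?leq_max ?leqnn ?orbT// -big_split.
by apply: eq_bigr => m _; rewrite mcoeffD mulrDl.
Qed.

Lemma momentZ u c p : moment u (c *: p) = c * moment u p.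
Proof.
pose k := maxn (msize (c *: p)) (msize p).
rewrite !(@momentwE k) ?leq_max ?leqnn ?orbT// mulr_sumr.
by apply: eq_bigr => m _; rewrite mcoeffZ mulrA.
Qed.

Lemma momentX u m : moment u 'X_[m] = \prod_i u i (m i).
Proof. by rewrite /moment msuppX big_seq1 mcoeffX eqxx mul1r. Qed.

Lemma moment0 u : moment u 0 = 0.
Proof. by rewrite /moment msupp0 big_nil. Qed.

Lemma moment_sum u (I : Type) (l : seq I) (P : pred I) (F : I -> {mpoly R[n]}) :
  moment u (\sum_(k <- l | P k) F k) = \sum_(k <- l | P k) moment u (F k).
Proof. exact: (big_morph _ (momentD u) (moment0 u)). Qed.

Lemma moment_eval (x : 'I_n -> R) p : moment (fun i e => x i ^+ e) p = p.@[x].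
Proof. by []. Qed.

Lemma moment_coef m p : moment (fun i e => (e == m i)%:R) p = p@_m.
Proof.
elim/mpolyind: p => [|c m' p _ _ IH]; first by rewrite moment0 mcoeff0.
rewrite momentD momentZ IH mcoeffD mcoeffZ momentX mcoeffX; congr (_ * _ + _).
case: eqVneq => [->|mm'].
  by rewrite big1// => i _; rewrite eqxx.
have [i mi] : exists i, m' i != m i.
  apply/existsP; apply: contraNT mm'; rewrite negb_exists => /forallP E.
  by apply/eqP/mnmP => i; have := E i; rewrite negbK => /eqP.
by rewrite (bigD1 i)//= (negPf mi) mul0r.
Qed.

Lemma eq_moment u u' p : (forall i e, u i e = u' i e) -> moment u p = moment u' p.
Proof.
by move=> uu'; apply: eq_bigr => m _; congr (_ * _); apply: eq_bigr => i _.
Qed.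

Definition update u i (f : nat -> R) j := if j == i then f else u j.

Lemma prod_update u i f m :
  \prod_j update u i f j (m j) = f (m i) * \prod_(j | j != i) u j (m j).
Proof.
rewrite (bigD1 i)//= {1}/update eqxx; congr (_ * _).
by apply: eq_bigr => j /negPf ji; rewrite /update ji.
Qed.

(** The fundamental theorem of calculus in x_i: the assumption says that the i-th functional
    integrates powers from c to d. *)
Lemma moment_mderiv u i c d p :
  (forall e, u i e = (d ^+ e.+1 - c ^+ e.+1) / e.+1%:R) ->
  moment u p^`M(i) =
    moment (update u i (fun e => d ^+ e)) p - moment (update u i (fun e => c ^+ e)) p.
Proof.
move=> ui; elim/mpolyind: p => [|l m p _ _ IH]; first by rewrite mderiv0 !moment0 subr0.
rewrite mderivD mderivZ !momentD !momentZ IH mderivX momentZ !momentX !prod_update.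
rewrite (bigD1 i)//= ui mnmBE mnm1E eqxx.
have -> : \prod_(j | j != i) u j ((m - U_(i))%MM j) = \prod_(j | j != i) u j (m j).
  by apply: eq_bigr => j ji; rewrite mnmBE mnm1E eq_sym (negPf ji) subn0.
case: (m i) => [|e]; first by rewrite !expr0 mul0r; ring.
rewrite subn1 /= [_%:R * _]mulrA [_%:R * (_ / _)]mulrC divfK ?pnatr_eq0//; ring.
Qed.

Lemma moment_vanish u i c p : (forall e, u i e = c ^+ e) -> vanish i c p ->
  moment u p = 0.
Proof.
move=> ui /vanish_div[q ->].
elim/mpolyind: q => [|l m q _ _ IH]; first by rewrite mulr0 moment0.
rewrite mulrDr momentD IH addr0 -scalerAr momentZ mulrBl -scaleN1r momentD momentZ.
rewrite mul_mpolyC momentZ -mpolyXD !momentX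
  (bigD1 i)//= [in X in _ + X](bigD1 i)//= !ui.
rewrite mnmDE mnm1E eqxx add1n exprS.
have -> : \prod_(j | j != i) u j ((U_(i) + m)%MM j) = \prod_(j | j != i) u j (m j).
  by apply: eq_bigr => j ji; rewrite mnmDE mnm1E eq_sym (negPf ji).
ring.
Qed.

Lemma moment_mderiv_vanish u i c d p :
  (forall e, u i e = (d ^+ e.+1 - c ^+ e.+1) / e.+1%:R) ->
  vanish i c p -> vanish i d p -> moment u p^`M(i) = 0.
Proof.
move=> ui pc pd; rewrite (moment_mderiv _ ui).
have U f e : update u i f i e = f e by rewrite /update eqxx.
by rewrite (moment_vanish (U (fun e => d ^+ e)) pd) (moment_vanish (U (fun e =>
  c ^+ e)) pc) subr0.
Qed.

Definition moment_poly u i p : {poly R} :=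
  \sum_(m <- msupp p) (p@_m * \prod_(j | j != i) u j (m j)) *: 'X^(m i).

Lemma moment_poly_eval u i t p : (moment_poly u i p).[t] =
  moment (update u i (fun e => t ^+ e)) p.
Proof.
rewrite horner_sum; apply: eq_bigr => m _.
by rewrite hornerZ hornerXn prod_update; ring.
Qed.

(** The moment applies the functional u_i, which is arbitrary, to the coefficients of
    [moment_poly u i p]. *)
Lemma moment_poly_eq0 u i p : moment_poly u i p = 0 -> moment u p = 0.
Proof.
move=> p0; pose N := (msize p).
have -> : moment u p = \sum_(k < N) (moment_poly u i p)`_k * u i k.
  under eq_bigr do rewrite coef_sum mulr_suml.
  rewrite exchange_big /moment [LHS]big_seq [RHS]big_seq; apply: eq_bigr => m mp.
  have mN : (m i < N)%N.
    by apply: leq_ltn_trans (msize_mdeg_lt mp); rewrite mdegE (bigD1 i) ?leq_addr.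
  rewrite (bigD1 (Ordinal mN))//= coefZ coefXn eqxx mulr1 [X in _ = _ + X]big1 ?addr0.
    by rewrite [in LHS](bigD1 i)/=; ring.
  move=> k; rewrite -val_eqE /= => /negPf ki.
  by rewrite coefZ coefXn ki mulr0 mul0r.
by rewrite p0 big1// => k _; rewrite coef0 mul0r.
Qed.

End Moment.

(** * Polynomials in one variable on an interval *)

Section OneVariable.
Import numFieldNormedType.Exports.
Variable (R : realType).
Implicit Types (a b c d : R) (q Q : {poly R}).

Lemma poly_eq0_itv a b q : a < b -> (forall t, a <= t <= b -> q.[t] = 0) -> q = 0.
Proof.
move=> ab q0; pose rs := [seq a + (b - a) / k.+1%:R | k <- iota 0 (size q)].
apply: (@roots_geq_poly_eq0 _ q rs); last by rewrite size_map size_iota.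
- apply/allP => t /mapP[k _ ->]; apply/eqP/q0.
  have ba : 0 < b - a by rewrite subr_gt0.
  have k0 : 0 < k.+1%:R :> R by rewrite ltr0n.
  apply/andP; split; first by rewrite lerDl divr_ge0 ?ler0n ?ltW.
  by rewrite -lerBrDl ler_pdivrMr// ler_peMr ?ler1n// ltW.
- rewrite map_inj_uniq ?iota_uniq// => k l /addrI /(mulfI _).
  rewrite subr_eq0 gt_eqF// => /(_ isT)/invr_inj/eqP.
  by rewrite eqr_nat => /eqP[].
Qed.

(** By the mean value theorem the primitive is nondecreasing. If its end values agree it is constant
    on the interval, hence constant as a polynomial. *)
Lemma poly_int_ge0 a b q Q : a < b -> Q^`() = q -> (forall t, a <= t <= b ->
  0 <= q.[t]) ->
  Q.[a] <= Q.[b] /\ (Q.[a] = Q.[b] -> forall t, a <= t <= b -> q.[t] = 0).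
Proof.
move=> ab Qq q0.
have nondecr x y : a <= x -> x <= y -> y <= b -> Q.[x] <= Q.[y].
  move=> ax xy yb; move: xy; rewrite le_eqVlt => /orP[/eqP->//|xy].
  have [||z zxy E] := @MVT R (horner Q) (horner q) x y xy.
  - move=> z _; rewrite -Qq derivE; apply: DeriveDef; first exact: derivable_horner.
    by rewrite derive1E.
  - by apply: continuous_subspaceT; exact: continuous_horner.
  rewrite -subr_ge0 E mulr_ge0//; last by rewrite subr_ge0 ltW.
  apply: q0.
  move: zxy; rewrite in_itv /= => /andP[xz zy].
  by rewrite (le_trans ax (ltW xz)) (le_trans (ltW zy) yb).
split; first by apply: nondecr => //; exact: ltW.
move=> Qab t tab.
have Q0 : Q - Q.[a]%:P = 0.
  apply: (poly_eq0_itv ab) => s /andP[as_ sb]; rewrite !hornerE.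
  apply/eqP; rewrite subr_eq0 eq_le.
  by apply/andP; split; [rewrite Qab; exact: nondecr|exact: nondecr].
by rewrite -Qq (_ : Q = Q.[a]%:P) ?derivC ?horner0//; apply/eqP; rewrite -subr_eq0 Q0.
Qed.

Lemma Rintegral_poly a b q Q : a < b -> Q^`() = q ->
  \int[lebesgue_measure]_(t in `[a, b]%classic) q.[t] = Q.[b] - Q.[a].
Proof.
move=> ab Qq; rewrite /Rintegral (@continuous_FTC2 _ (horner q) (horner Q))//.
- by apply: continuous_subspaceT; exact: continuous_horner.
- split.
  + by move=> x _; exact: derivable_horner.
  + by apply: cvg_at_right_filter; exact: continuous_horner.
  + by apply: cvg_at_left_filter; exact: continuous_horner.
- by move=> x _; rewrite -derivE Qq.
Qed.

End OneVariable.

(** * Iterated integrals as moments *)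

Section IteratedIntegral.
Variables (R : realType) (n : nat) (a b : 'rV[R]_n).
Hypothesis a_lt_b : forall i, a ord0 i < b ord0 i.
Implicit Types (p q : {mpoly R[n]}) (i j : 'I_n) (l : seq 'I_n) (x y : 'rV[R]_n).

Definition face_moment l x i (e : nat) : R :=
  if i \in l then (b ord0 i ^+ e.+1 - a ord0 i ^+ e.+1) / e.+1%:R
  else x ord0 i ^+ e.

Definition set_coord x i t : 'rV[R]_n := \row_j (if j == i then t else x ord0 j).

Lemma box_set_coord x i t : box a b x -> a ord0 i <= t <= b ord0 i ->
  box a b (set_coord x i t).
Proof. by move=> bx ti j; rewrite mxE; case: eqVneq => [->|_]. Qed.

Definition prim_moment_poly (u : 'I_n -> nat -> R) i p : {poly R} :=
  \sum_(m <- msupp p)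
     (p@_m * \prod_(j | j != i) u j (m j) / (m i).+1%:R) *: 'X^((m i).+1).

Lemma deriv_prim_moment_poly u i p : (prim_moment_poly u i p)^`() = moment_poly u i p.
Proof.
rewrite raddf_sum; apply: eq_bigr => m _ /=.
by rewrite derivZ derivXn -scalerMnr scalerMnl
  -[_ *+ _]mulr_natr divfK ?pnatr_eq0.
Qed.

Lemma moment_face_moment_cons i l x p : i \notin l ->
  moment (face_moment (i :: l) x) p =
  (prim_moment_poly (face_moment l x) i p).[b ord0 i] - (prim_moment_poly
    (face_moment l x) i p).[a ord0 i].
Proof.
move=> il; rewrite /prim_moment_poly !horner_sum -sumrB; apply: eq_bigr => m _.
rewrite !hornerZ !hornerXn (bigD1 i)//= {1}/face_moment mem_head.
have -> : \prod_(j | j != i) face_moment (i :: l) x j (m j) =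
  \prod_(j | j != i) face_moment l x j (m j).
  by apply: eq_bigr => j /negPf ji; rewrite /face_moment inE ji.
ring.
Qed.

Lemma moment_poly_face_moment_eval i l x t p : i \notin l ->
  (moment_poly (face_moment l x) i p).[t] = moment (face_moment l (set_coord x i t)) p.
Proof.
move=> /negPf il; rewrite moment_poly_eval; apply: eq_moment => j e;
  rewrite /update /face_moment mxE.
by case: eqVneq => [->|_]; rewrite ?il.
Qed.

(** The integrand need only be polynomial on the box, since the successive integrations never leave
    it; this accommodates restrictions extended by zero. *)
Lemma iterated_integralE l g p x : uniq l -> box a b x ->
  (forall y, box a b y -> g y = p.@[y ord0]) ->
  iterated_integral a b l g x = moment (face_moment l x) p.
Proof.
move=> + + gp; elim: l x => [|i l IH] x /=; first by move=> _ /gp ->.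
move=> /andP[il ul] bx.
rewrite (moment_face_moment_cons _ _ il) -(Rintegral_poly (a_lt_b i)
  (deriv_prim_moment_poly _ _ _)).
apply: eq_Rintegral => t /set_mem /=; rewrite in_itv /= => tab.
by rewrite IH ?moment_poly_face_moment_eval//; exact: box_set_coord.
Qed.

(** One variable at a time: the inner moment is a nonnegative polynomial in the outer variable, so a
    zero integral forces it to vanish for every value of that variable. *)
Lemma moment_face_moment_ge0 l p x : uniq l -> box a b x ->
  (forall y, box a b y -> 0 <= p.@[y ord0]) ->
  0 <= moment (face_moment l x) p /\
  (moment (face_moment l x) p = 0 -> forall y, box a b y ->
     (forall j, j \notin l -> y ord0 j = x ord0 j) -> p.@[y ord0] = 0).
Proof.
move=> + + p0; elim: l x => [|i l IH] x /=.
  move=> _ bx; split; first exact: p0.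
  move=> px y _ yx; rewrite (_ : p.@[y ord0] = p.@[x ord0]) ?px//.
  by apply: meval_eq => j; rewrite yx.
move=> /andP[il ul] bx.
have q0 t : a ord0 i <= t <= b ord0 i -> 0 <= (moment_poly (face_moment l x) i p).[t].
  by move=> tab; rewrite moment_poly_face_moment_eval//;
    case: (IH (set_coord x i t)) => //; exact: box_set_coord.
have [Qab Qeq] := poly_int_ge0 (a_lt_b i) (deriv_prim_moment_poly _ _ _) q0.
rewrite (moment_face_moment_cons _ _ il) subr_ge0; split=> // /eqP;
  rewrite subr_eq0 => /eqP/esym Q0 y yb yx.
have := Qeq Q0 _ (yb i); rewrite moment_poly_face_moment_eval// => M0.
case: (IH (set_coord x i (y ord0 i))) => // [|_ H]; first exact: box_set_coord.
apply: (H M0) => // j jl; rewrite mxE; case: eqVneq => [->//|ji].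
by apply: yx; rewrite inE negb_or ji.
Qed.

(** The list [l] holds the variables whose evaluation has been replaced by an arbitrary functional
    of the powers. Once all are freed, the functional can be chosen to extract a coefficient. *)
Lemma mpoly_eq0_box p : (forall x, box a b x -> p.@[x ord0] = 0) -> p = 0.
Proof.
move=> p0.
have H l (u : 'I_n -> nat -> R) : (forall i, i \notin l ->
    exists2 t, a ord0 i <= t <= b ord0 i & forall e, u i e = t ^+ e) -> moment u p = 0.
  elim: l u => [|i l IH] u Hu.
    have /(_ _)/cid2-/all_sig2[t tab ut] i := Hu i isT.
    rewrite (@eq_moment _ _ _ (fun i e => t i ^+ e))// moment_eval.
    rewrite (_ : p.@[t] = p.@[(\row_i t i : 'rV[R]_n) ord0]); last first.
      by apply: meval_eq => i; rewrite mxE.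
    by apply: p0 => i; rewrite mxE.
  apply: (@moment_poly_eq0 _ _ _ i); apply: (poly_eq0_itv (a_lt_b i)) => t tab.
  rewrite moment_poly_eval; apply: IH => j jl; rewrite /update; case: eqVneq => [->|ji].
    by exists t.
  by apply: Hu; rewrite inE negb_or ji.
apply/mpolyP => m; rewrite mcoeff0 -moment_coef; apply: (H (enum 'I_n)) => i.
by rewrite mem_enum.
Qed.

Lemma corner_box (f : face n) : box a b (face_corner a b f).
Proof. by move=> i; rewrite mxE; case: ifP => _; rewrite lexx ltW. Qed.

(** A test form with the single component dx_(F \ s) isolates the coefficient of dx_s, as [s] is the
    only complement of F \ s in F. *)
Lemma dofE (f : face n) (w : pform R n) (s : {set 'I_n}) q :
  s \subset face_free f ->
  dof a b f (dx_term q (face_free f :\: s)) (restrict_form (box a b) w) =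
  (-1) ^+ inversions s (face_free f :\: s) *
  moment (face_moment (enum (face_free f)) (face_corner a b f)) (w s * q).
Proof.
move=> sF; rewrite -momentZ; apply: iterated_integralE;
  [exact: enum_uniq|exact: corner_box|].
move=> y yb; rewrite wedgeE (bigD1 s)//= big1 ?addr0; last first.
  move=> t /andP[tF ts]; rewrite [eval_form _ _ _]ffunE [dx_term _ _ _]ffunE.
  case: eqP => [E|_]; last by rewrite meval0 !mulr0.
  have K (u : {set 'I_n}) : u \subset face_free f ->
    face_free f :\: (face_free f :\: u) = u.
    by move=> uF; rewrite setDDr setDv set0U; exact/setIidPr.
  by case/eqP: ts; rewrite -(K t tF) E K.
rewrite [eval_form _ _ _]ffunE [dx_term _ _ _]ffunE eqxx [face_trace _ _ _ _]ffunE sF.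
rewrite /restrict_form /patch ifT ?ffunE; last exact: mem_set.
by rewrite mevalZ mevalM.
Qed.

End IteratedIntegral.

(** * Unisolvence *)

Section Unisolvence.
Variables (R : realType) (n : nat) (a b : 'rV[R]_n).
Hypothesis a_lt_b : forall i, a ord0 i < b ord0 i.
Implicit Types (F s t : {set 'I_n}) (x y : 'rV[R]_n) (p q : {mpoly R[n]}).
Implicit Types (w : pform R n) (i j : 'I_n) (m : 'X_{1..n}).

Lemma subst_id_msupp F (x : 'I_n -> R) p m i :
  subst F x p = p -> m \in msupp p -> i \notin F -> m i = 0%N.
Proof.
move=> pE; rewrite -pE => /subst_msupp[m' _ ->] /negPf iF.
by rewrite mnmE iF.
Qed.

Lemma moment_subst (u : 'I_n -> nat -> R) F (x : 'I_n -> R) p :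
  (forall i e, i \notin F -> u i e = x i ^+ e) -> moment u (subst F x p) = moment u p.
Proof.
move=> ux; elim/mpolyind: p => [|c m p _ _ IH]; first by rewrite subst0.
rewrite subst_linear !momentD !momentZ IH substX momentZ !momentX; congr (_ * _ + _).
rewrite big_mkcond -big_split; apply: eq_bigr => i _ /=; rewrite mnmE.
case: (boolP (i \in F)) => [_|iF] /=; first by rewrite mul1r.
by rewrite !ux// expr0 mulr1.
Qed.

Lemma msize_attained p : p != 0 -> exists2 m, m \in msupp p & (mdeg m).+1 = msize p.
Proof. by move=> p0; exists (mlead p); [exact: mlead_supp|exact: mlead_deg]. Qed.

Lemma quadratic_sign (J : seq 'I_n) y : box a b y ->
  0 <= (-1) ^+ size J * (\prod_(j <- J) (y ord0 j - a ord0 j) *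
                         \prod_(j <- J) (y ord0 j - b ord0 j)) :> R.
Proof.
move=> yb; elim: J => [|j J IH]; first by rewrite !big_nil !mulr1.
rewrite !big_cons /= exprS.
have -> (c A u B v : R) : -1 * c * (A * u * (B * v)) =
  (A * - B) * (c * (u * v)) by ring.
by rewrite mulr_ge0// mulr_ge0// ?opprB subr_ge0; have /andP[] := yb j.
Qed.

(** For T = r + k + 1 the test polynomials have degree at most r - 2(#F - k). The pairs (r, k) and
    (r - 1, k + 1) share this T, so the lemma serves for a form and for its exterior derivative. *)
Lemma closed_unisolvent F x k T w :
  box a b x -> (k < T)%N ->
  ptrace F (x ord0) w = w -> fdeg k w -> wt_lt T (koszul w) -> ext_d w = 0 ->
  (forall s j, s \subset F -> j \in F -> j \notin s ->
     vanish j (a ord0 j) (w s) /\ vanish j (b ord0 j) (w s)) ->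
  (forall s q, s \subset F -> #|s| = k -> subst F (x ord0) q = q ->
     (forall m, m \in msupp q -> mdeg m + 2 * (#|F| - k) + k < T)%N ->
     moment (face_moment a b (enum F) x) (w s * q) = 0) ->
  w = 0.
Proof.
move=> bx kT trw wk Kw dw van orth.
have wF s : w s != 0 -> s \subset F.
  by rewrite -trw ffunE; case: ifP => //; rewrite eqxx.
have wsub s : subst F (x ord0) (w s) = w s.
  by rewrite -trw ffunE; case: ifP => _; rewrite ?subst0// subst_subst setIid.
have wk' s : w s != 0 -> #|s| = k.
  by move=> /msize_attained[m /component_msupp/wk].
have deg s m : m \in msupp (w s) -> (mdeg m + k < T)%N.
  pose D := (\max_s msize (w s))%N.
  have leD s' : (msize (w s') <= D)%N := leq_bigmax s'.
  (* The top degree over all coefficients is D - 1. If it were too large, [closed_top_eq0] would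
     kill the component of a term of that degree. *)
  suff DT : (D + k <= T)%N.
    by move=> /msize_mdeg_lt ms; have := leD s; lia.
  rewrite leqNgt; apply/negP => DT.
  have T0 : (0 < #|{set 'I_n}|)%N by apply/card_gt0P; exists set0.
  have [s0 Ds0] : {s0 : {set 'I_n} | (\max_s msize (w s))%N = msize (w s0)}.
    exact: bigop.eq_bigmax.
  rewrite -/D in Ds0.
  have w0 : w s0 != 0 by rewrite -msize_poly_eq0 -Ds0; lia.
  have [m0 m0s mD] := msize_attained w0.
  have /negP := component_msupp m0s; apply; apply/eqP.
  set c := (m0 + mnm_set s0)%MM.
  have cD : (mdeg c = D.-1 + k)%N by rewrite mdegD mdeg_mnm_set (wk' _ w0); lia.
  have H : component c w = 0; last by rewrite H ffunE.
  apply: (@closed_top_eq0 _ _ F c T k).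
  - move=> i iF; rewrite mnmDE (subst_id_msupp (wsub s0) m0s iF) mnm_setE.
    by rewrite (negPf (contra (fintype.subsetP (wF _ w0) i) iF)).
  - move=> s1 s1N; have [s1c ms1 cE] := component_neq0 s1N.
    have w1 : w s1 != 0 by apply: contraTneq ms1 => ->; rewrite msupp0.
    split=> //; [exact: wF|exact: wk'|].
    move=> i iF is1; have [va vb] := van s1 i (wF _ w1) iF is1.
    have ab : a ord0 i != b ord0 i by rewrite lt_eqF.
    have := vanish_top ab va vb ms1.
    rewrite mnmBE mnm_setE (negPf is1) subn0; apply.
    (* All terms of this component have form degree k, hence the same degree D - 1, so [vanish_top]
       applies to each of them. *)
    have cm : (mdeg (c - mnm_set s1)%MM + k = D.-1 + k)%N.
      by rewrite -cD [in RHS]cE mdegD mdeg_mnm_set (wk' _ w1).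
    apply: leq_trans (leD s1) _; rewrite (addIn cm); exact: leqSpred.
  - by move=> s1; rewrite -component_koszul => /Kw.
  - by rewrite -component_ext_d dw component0.
  - by rewrite cD; lia.
  - by [].
apply/ffunP => s; rewrite [RHS]ffunE; apply/eqP/negPn/negP => ws0.
have sF := wF _ ws0; have sk := wk' _ ws0.
pose J := enum (F :\: s).
pose L := [seq (j, a ord0 j) | j <- J] ++ [seq (j, b ord0 j) | j <- J].
have JE j : (j \in J) = (j \notin s) && (j \in F) by rewrite mem_enum inE.
have [||q0 wq0] := @vanish_div_all _ _ L (w s).
- rewrite cat_uniq !map_inj_uniq ?enum_uniq ?andbT /=; do ?by move=> j j' [].
  apply/hasPn => -[j c] /mapP[j' _ [-> ->]]; apply/mapP => -[j'' _ [<- E]].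
  by have := a_lt_b j'; rewrite E ltxx.
- move=> [j c]; rewrite mem_cat => /orP[] /mapP[j' + [-> ->]];
  rewrite JE => /andP[js jF] /=.
    by have [] := van s j' sF jF js.
  by have [] := van s j' sF jF js.
pose P := \prod_(z <- L) ('X_z.1 - z.2%:MP : {mpoly R[n]}).
have PE : P = \prod_(j <- J) ('X_j - (a ord0 j)%:MP) * \prod_(j <- J) ('X_j -
  (b ord0 j)%:MP).
  by rewrite /P big_cat !big_map.
have subP : subst F (x ord0) P = P.
  rewrite /P subst_prod; apply: eq_big_seq => -[j c] /=.
  move=> jL; have jF : j \in F.
    by move: jL; rewrite mem_cat => /orP[] /mapP[j' + [-> _]]; rewrite JE => /andP[].
  exact: subst_XsubC_id.
pose q := subst F (x ord0) q0.
have qF : subst F (x ord0) q = q by rewrite /q subst_subst setIid.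
have wq : w s = P * q by rewrite -(wsub s) wq0 substM subP.
have q_neq0 : q != 0 by apply: contraNneq ws0 => q0'; rewrite wq q0' mulr0.
have szw : msize (w s) = (2 * (#|F| - k) + msize q)%N.
  by rewrite wq msize_prod_XsubC// size_cat !size_map /J -cardE cardsD
    (setIidPr sF) sk addnn -mul2n.
(* The cofactor q is an admissible test polynomial: its degree plus 2(#F - k) is the degree of
   [w s], bounded by [deg]. *)
have M0 : moment (face_moment a b (enum F) x) (w s * q) = 0.
  apply: orth => // m /msize_mdeg_lt mq.
  have [m0 /deg m0T m0s] := msize_attained ws0; move: m0T m0s mq.
  by rewrite szw; move: (msize q) => B; lia.
(* Up to sign this is P q^2; each (x_j - a_j)(x_j - b_j) is nonpositive on the box, and the sign
   makes G nonnegative. *)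
pose G := (-1) ^+ size J *: (w s * q) : {mpoly R[n]}.
have GE y : G.@[y ord0] = (-1) ^+ size J * (\prod_(j <- J) (y ord0 j - a ord0 j) *
    \prod_(j <- J) (y ord0 j - b ord0 j)) * (q.@[y ord0] ^+ 2).
  rewrite mevalZ wq PE !mevalM expr2 -!mulrA.
  have E (c : 'rV[R]_n) : (\prod_(j <- J) ('X_j - (c ord0 j)%:MP)).@[y ord0] =
      \prod_(j <- J) (y ord0 j - c ord0 j).
    by rewrite rmorph_prod; apply: eq_bigr => j _; rewrite /= mevalB mevalXU mevalC.
  by rewrite !E.
have G0 y : box a b y -> 0 <= G.@[y ord0].
  by move=> yb; rewrite GE mulr_ge0 ?sqr_ge0//; exact: quadratic_sign.
have [_ /(_ _)Gz] := moment_face_moment_ge0 a_lt_b (enum_uniq F) bx G0.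
have subG : subst F (x ord0) G = G by rewrite /G substZ substM wsub qF.
suff : G = 0.
  move/eqP; rewrite scaler_eq0 signr_eq0 mulf_eq0 (negPf ws0) (negPf q_neq0).
  by [].
apply: (mpoly_eq0_box a_lt_b) => y yb; rewrite -subG meval_subst.
pose y' : 'rV[R]_n := \row_i (if i \in F then y ord0 i else x ord0 i).
rewrite (_ : _.@[_] = G.@[y' ord0]); last by apply: meval_eq => i; rewrite mxE.
apply: Gz; first by rewrite momentZ M0 mulr0.
  by move=> i; rewrite mxE; case: ifP.
by move=> i; rewrite mem_enum mxE => /negPf ->.
Qed.

Lemma trace_unisolvent F x k r w :
  box a b x -> (0 < r)%N ->
  ptrace F (x ord0) w = w -> fdeg k w -> shape_class (r + k).+1 w ->
  (forall s j, s \subset F -> j \in F -> j \notin s ->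
     vanish j (a ord0 j) (w s) /\ vanish j (b ord0 j) (w s)) ->
  (forall s q, s \subset F -> #|s| = k -> subst F (x ord0) q = q ->
     (forall m, m \in msupp q -> mdeg m + 2 * (#|F| - k) + k < (r + k).+1)%N ->
     moment (face_moment a b (enum F) x) (w s * q) = 0) ->
  w = 0.
Proof.
move=> bx r0 trw wk [Kw Kdw] van orth.
have kT : (k < (r + k).+1)%N by lia.
apply: (closed_unisolvent bx kT trw wk Kw) => //.
(* This is where r >= 1 matters: the derivative has form degree k + 1, which must stay below T. *)
have kT1 : (k.+1 < (r + k).+1)%N by lia.
apply: (@closed_unisolvent F x k.+1 _ _ bx kT1 _ (fdeg_ext_d wk) Kdw (ext_dK w)).
- by rewrite ptrace_ext_d trw.
(* As j is not in s, only derivatives in directions other than j occur, and these commute with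
   setting x_j = c. *)
- have H s j c : s \subset F -> j \in F -> j \notin s ->
      (forall t, t \subset F -> j \notin t -> vanish j c (w t)) ->
        vanish j c (ext_d w s).
    move=> sF jF js v; rewrite /vanish ext_dE subst_sum big1// => i si.
    have ij : i != j by apply: contraNneq js => <-.
    rewrite substZ subst_mderiv ?inE// v ?mderiv0 ?scaler0//.
      exact: fintype.subset_trans (subsetDl _ _) sF.
    by rewrite !inE negb_and js orbT.
  move=> s j sF jF js; split; apply: H => // t tF jt.
    by have [] := van t j tF jF jt.
  by have [] := van t j tF jF jt.
(* By parts: i is not in s \ i, so the boundary terms vanish. The degree lost by the derivative of q
   balances the passage from 2(#F - k - 1) + k + 1 to 2(#F - k) + k. *)
- move=> s q sF sk qF qd; rewrite ext_dE mulr_suml moment_sum big1// => i si.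
  have iF := fintype.subsetP sF _ si.
  have siF : s :\ i \subset F := fintype.subset_trans (subsetDl _ _) sF.
  have [va vb] := van (s :\ i) i siF iF (negbT (setD11 i s)).
  have sik : #|s :\ i| = k by move: sk; rewrite (cardsD1 i s) si => -[].
  rewrite -scalerAl momentZ.
  have M0 : moment (face_moment a b (enum F) x) (w (s :\ i) * q)^`M(i) = 0.
    apply: (@moment_mderiv_vanish _ _ _ _ (a ord0 i) (b ord0 i)).
    - by move=> e; rewrite /face_moment mem_enum iF.
    - by rewrite /vanish substM va mul0r.
    - by rewrite /vanish substM vb mul0r.
  move: M0; rewrite mderivM momentD [X in _ + X]orth ?addr0//.
  + by move=> ->; rewrite mulr0.
  + by rewrite subst_mderiv// qF.
  + move=> m; rewrite mcoeff_msupp mcoeff_deriv mulrn_eq0 /= -mcoeff_msupp.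
    move=> /qd; rewrite mdegD mdeg1.
    have kF : (k < #|F|)%N by rewrite -sk subset_leq_card.
    by move: kF; move: #|F| => N; lia.
Qed.

Lemma fdeg_SL r k w : SL r k%:Z w -> fdeg k w.
Proof.
case/SL_gen=> p [e [f [Pp [ek _] [fk _] ->]]].
apply: spannedD; last first.
  move=> c s; rewrite component_ext_d => /eps_ext_neq0[i [si _]].
  rewrite component_koszul => /iota_ext_neq0[j [sj _ /fk]].
  by rewrite cardsU1 sj (cardsD1 i s) si.
apply: spannedD; last exact: fdeg_koszul.
by move=> c s /Pp[].
Qed.

Lemma ptrace_eq0 r k w : (0 < r)%N -> SL r k%:Z w ->
  (forall (d : nat) (f : face n) (nu : pform R n),
     (k <= d <= minn n (r %/ 2 + k))%N -> face_dim f = d ->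
     PL_face f (r - 2 * (d - k))%N (d - k)%N nu ->
     dof a b f nu (restrict_form (box a b) w) = 0) ->
  forall f : face n, ptrace (face_free f) (face_corner a b f ord0) w = 0.
Proof.
move=> r0 wS dof0 f; have wk := fdeg_SL wS.
have wk' s : w s != 0 -> #|s| = k by move=> /msize_attained[m /component_msupp/wk].
have [N] := ubnP #|face_free f|; elim: N f => // N IH f fN.
set F := face_free f; set x := face_corner a b f.
have bx : box a b x by exact: corner_box.
(* Faces of dimension below k carry no nonzero k-form. *)
have [Fk|kF] := ltnP #|F| k.
  apply/ffunP => s; rewrite !ffunE; case: ifP => // sF.
  have [->|/wk' sk] := eqVneq (w s) 0; first by rewrite subst0.
  by have := subset_leq_card sF; lia.
apply: (trace_unisolvent bx r0 _ _ (shape_class_ptrace_SL _ _ wS)).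
- exact: ptrace_idem.
- exact: fdeg_ptrace.
- have V s j (e : bool) : s \subset F -> j \in F -> j \notin s ->
      vanish j (if e then b ord0 j else a ord0 j) (ptrace F (x ord0) w s).
    move=> sF jF js; rewrite /vanish ffunE sF.
    (* The facet of [f] on which x_j equals b_j or a_j; its other fixed coordinates are those of
       [f]. *)
    pose f' := Face (F :\ j) [ffun i => if i == j then e else face_side f i].
    pose x' := face_corner a b f'.
    have x'j : x' ord0 j = if e then b ord0 j else a ord0 j.
      by rewrite mxE ffunE eqxx.
    rewrite (eq_subst (y := x' ord0)); last first.
      by move=> i; rewrite !inE negbK => /eqP ->.
    rewrite [subst F _ _](eq_subst (y := x' ord0)); last first.
      move=> i iF; rewrite !mxE ffunE; case: eqVneq => [ij|//].
      by rewrite -ij (negPf iF) in jF.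
    rewrite subst_subst.
    have f'N : (#|F :\ j| < N)%N by move: fN; rewrite -/F (cardsD1 j F) jF.
    have /ffunP/(_ s) := IH f' f'N; rewrite ffunE [RHS]ffunE /= subsetD1 sF js /=.
    rewrite (_ : [set~ j] :&: F = F :\ j) => [H|]; first exact H.
    by apply/setP => i; rewrite !inE.
  move=> s j sF jF js; split.
    exact: (V s j false).
  exact: (V s j true).
- move=> s q sF sk qF qd; rewrite ffunE sF.
  (* A nonzero q has a term, whose degree bound gives 2(#F - k) <= r: the dimension of the face is
     then in the range of the degrees of freedom. *)
  have [->|q0] := eqVneq q 0; first by rewrite mulr0 moment0.
  have [m0 /qd m0d _] := msize_attained q0.
  have := dof0 #|F| f (dx_term q (F :\: s)) _ erefl.
  rewrite (dofE a_lt_b _ _ sF) => D0.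
  rewrite -qF -substM moment_subst; last by move=> i e iF;
    rewrite /face_moment mem_enum (negPf iF).
  apply: (@mulfI _ ((-1) ^+ inversions s (F :\: s))); first by rewrite signr_eq0.
  rewrite mulr0; apply: D0.
    have := max_card (mem F); rewrite card_ord leq_min kF /= => -> /=.
    by rewrite addnC -leq_subLR leq_divRL// mulnC; move: m0d; move: #|F| => M; lia.
  have FsE : #|F :\: s| = (#|F| - k)%N by rewrite cardsD (setIidPr sF) sk.
  split=> t m; rewrite ffunE; case: eqP => [->|]; rewrite ?msupp0// => mq.
    by split; [rewrite FsE|have := qd m mq; move: #|F| => M; lia].
  split; first exact: subsetDl.
  by move=> i; exact: subst_id_msupp qF mq.
Qed.

End Unisolvence.

(** * The shape functions as a space of monomials *)

Section Glue.
Variables (R : realType) (n : nat).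
Implicit Types (s t : {set 'I_n}) (i j : 'I_n) (w : pform R n).
Implicit Types (b m : 'X_{1..n}) (v : {ffun {set 'I_n} -> R}) (c : R).

Definition scale_ext c v : {ffun {set 'I_n} -> R} := [ffun s : {set 'I_n} => c * v s].

Lemma iota_extZ u c v : iota_ext u (scale_ext c v) = scale_ext c (iota_ext u v).
Proof.
apply/ffunP => s; rewrite !ffunE mulr_sumr; apply: eq_bigr => i _.
by rewrite ffunE; ring.
Qed.

Lemma eps_extZ u c v : eps_ext u (scale_ext c v) = scale_ext c (eps_ext u v).
Proof.
apply/ffunP => s; rewrite !ffunE mulr_sumr; apply: eq_bigr => i _.
by rewrite ffunE; ring.
Qed.

Definition kappa_at b v := iota_ext (fun i => (0 < b i)%N%:R) v.
Definition d_at b v := eps_ext (fun i => (b i)%:R) v.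
Definition wedge_at i v := eps_ext (fun j => (j == i)%:R) v.

Lemma kappa_atD b v1 v2 : kappa_at b (v1 + v2) = kappa_at b v1 + kappa_at b v2.
Proof. exact: iota_extD. Qed.
Lemma d_atD b v1 v2 : d_at b (v1 + v2) = d_at b v1 + d_at b v2.
Proof. exact: eps_extD. Qed.
Lemma wedge_atD i v1 v2 : wedge_at i (v1 + v2) = wedge_at i v1 + wedge_at i v2.
Proof. exact: eps_extD. Qed.
Lemma kappa_atZ b c v : kappa_at b (scale_ext c v) = scale_ext c (kappa_at b v).
Proof. exact: iota_extZ. Qed.
Lemma d_atZ b c v : d_at b (scale_ext c v) = scale_ext c (d_at b v).
Proof. exact: eps_extZ. Qed.
Lemma wedge_atZ i c v : wedge_at i (scale_ext c v) = scale_ext c (wedge_at i v).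
Proof. exact: eps_extZ. Qed.
Lemma kappa_atK b v : kappa_at b (kappa_at b v) = 0. Proof. exact: iota_iota. Qed.
Lemma scale_extD c v1 v2 : scale_ext c (v1 + v2) = scale_ext c v1 + scale_ext c v2.
Proof. by apply/ffunP => s; rewrite !ffunE mulrDr. Qed.
Lemma scale_extA c c' v : scale_ext c (scale_ext c' v) = scale_ext (c * c') v.
Proof. by apply/ffunP => s; rewrite !ffunE mulrA. Qed.
Lemma scale_ext1 v : scale_ext 1 v = v.
Proof. by apply/ffunP => s; rewrite !ffunE mul1r. Qed.
Lemma scale_ext0 c : scale_ext c 0 = 0.
Proof. by apply/ffunP => s; rewrite !ffunE mulr0. Qed.
Lemma kappa_at0 b : kappa_at b 0 = 0.
Proof. by apply/ffunP => s; rewrite !ffunE big1// => i _; rewrite ffunE !mulr0. Qed.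
Lemma d_at0 b : d_at b 0 = 0.
Proof. by apply/ffunP => s; rewrite !ffunE big1// => i _; rewrite ffunE !mulr0. Qed.
Lemma wedge_at0 i : wedge_at i 0 = 0.
Proof. by apply/ffunP => s; rewrite !ffunE big1// => j _; rewrite ffunE !mulr0. Qed.

Lemma kappa_at_d_at b v : kappa_at b (d_at b v) + d_at b (kappa_at b v) =
  scale_ext (mdeg b)%:R v.
Proof. by apply/ffunP => s; rewrite !ffunE -iota_eps_mdeg /kappa_at /d_at !ffunE. Qed.

Lemma kappa_at_wedge_at b i v : (0 < b i)%N ->
  kappa_at b (wedge_at i v) + wedge_at i (kappa_at b v) = v.
Proof.
move=> bi; apply/ffunP => s; rewrite [LHS]ffunE iota_eps (bigD1 i)//= big1 ?addr0.
  by rewrite bi eqxx !mul1r.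
by move=> j /negPf ->; rewrite mulr0.
Qed.

Definition restrict_supp b v : {ffun {set 'I_n} -> R} :=
  [ffun s : {set 'I_n} => if s \subset bsupp b then v s else 0].

Definition lift_form b v : pform R n :=
  [ffun s : {set 'I_n} => if s \subset bsupp b then v s *: 'X_[b - mnm_set s] else 0].

Lemma component_lift b b' v : component b' (lift_form b v) =
  if b' == b then restrict_supp b v else 0.
Proof.
apply/ffunP => s; rewrite ffunE [lift_form _ _ _]ffunE; case: ifPn => sb'; last first.
  by case: eqP => [<-|_]; rewrite ffunE ?(negPf sb').
case: ifPn => sb; last first.
  by rewrite mcoeff0; case: eqP => _; rewrite ffunE ?(negPf sb).
rewrite mcoeffZ mcoeffX; case: (eqVneq b' b) => [->|bb'].
  by rewrite eqxx mulr1 ffunE sb.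
rewrite ffunE (_ : (_ == _) = false) ?mulr0//; apply/eqP => /mnmP E.
case/eqP: bb'; apply/mnmP => i; have := E i; rewrite !mnmBE mnm_setE.
case: (boolP (i \in s)) => [is_|_]; last by rewrite !subn0.
by move: (fintype.subsetP sb _ is_) (fintype.subsetP sb' _ is_); rewrite !inE; lia.
Qed.

Lemma restrict_supp_id b v : (forall s, v s != 0 -> s \subset bsupp b) ->
  restrict_supp b v = v.
Proof.
move=> H; apply/ffunP => s; rewrite ffunE; case: ifPn => // /negPf sb.
by have [->//|/H] := eqVneq (v s) 0; rewrite sb.
Qed.

Lemma restrict_supp_component b w : restrict_supp b (component b w) = component b w.
Proof. by apply: restrict_supp_id => s /component_neq0[]. Qed.

Lemma restrict_supp_kappa_at b v : restrict_supp b (kappa_at b v) =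
  kappa_at b (restrict_supp b v).
Proof.
apply/ffunP => s; rewrite !ffunE; case: ifPn => sb; last first.
  rewrite big1// => i _; rewrite ffunE bsuppU1 (negPf sb) andbF; ring.
apply: eq_bigr => i _; rewrite ffunE bsuppU1 sb andbT.
by case: (0 < b i)%N; rewrite ?mul0r.
Qed.

Lemma restrict_supp_d_at b v : restrict_supp b (d_at b v) = d_at b (restrict_supp b v).
Proof.
apply/ffunP => s; rewrite !ffunE; case: ifPn => sb; last first.
  rewrite big1// => i si; rewrite ffunE; case: ifP => sib; last by ring.
  have := bsuppU1 b i (s :\ i); rewrite setD1K // (negPf sb) sib andbT => /esym.
  by case: (b i) => // _; ring.
apply: eq_bigr => i si; rewrite ffunE.
by rewrite (fintype.subset_trans (subsetDl _ _) sb).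
Qed.

Lemma restrict_supp_wedge_at b i v : (0 < b i)%N ->
  restrict_supp b (wedge_at i v) = wedge_at i (restrict_supp b v).
Proof.
move=> bi; apply/ffunP => s; rewrite !ffunE; case: ifPn => sb; last first.
  rewrite big1// => j sj; case: (eqVneq j i) => [ji|_]; last by rewrite mul0r mulr0.
  rewrite ffunE ifF; first by rewrite !mulr0.
  apply: contraNF sb => sjb; rewrite -(setD1K sj) bsuppU1 sjb ji bi //.
apply: eq_bigr => j sj; rewrite ffunE.
by rewrite (fintype.subset_trans (subsetDl _ _) sb).
Qed.

Lemma koszul_lift b v : koszul (lift_form b v) = lift_form b (kappa_at b v).
Proof.
apply: componentP => b'; rewrite component_koszul !component_lift
  restrict_supp_kappa_at.
by case: eqP => [->//|_]; exact: kappa_at0.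
Qed.

Lemma ext_d_lift b v : ext_d (lift_form b v) = lift_form b (d_at b v).
Proof.
apply: componentP => b'; rewrite component_ext_d !component_lift restrict_supp_d_at.
by case: eqP => [->//|_]; exact: d_at0.
Qed.

Lemma liftD b v1 v2 : lift_form b (v1 + v2) = lift_form b v1 + lift_form b v2.
Proof.
apply/ffunP => s; rewrite !ffunE; case: ifP => _; rewrite ?addr0// scalerDl //.
Qed.

(* An index i with b_i >= 2 if there is one, and otherwise with b_i = 1. *)
Definition pivot b : option 'I_n :=
  if [pick i | (1 < b i)%N] is Some i then Some i else [pick i | (0 < b i)%N].

Variant pivot_spec b : option 'I_n -> Prop :=
| PivotNone of b = 0%MM : pivot_spec b None
| PivotSome i of (0 < b i)%N & (1 < b i)%N \/ (forall j, (b j <= 1)%N) :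
    pivot_spec b (Some i).

Lemma pivotP b : pivot_spec b (pivot b).
Proof.
rewrite /pivot; case: pickP => [i bi|b1]; first by constructor; [exact: ltnW|left].
have {}b1 j : (b j <= 1)%N by rewrite leqNgt b1.
case: pickP => [i bi|b0]; first by constructor => //; right.
by constructor; apply/mnmP => i; rewrite mnm0E; have := b0 i; lia.
Qed.

(** With h the wedge product with the pivot, v = kappa h v + h kappa v. The first summand is kept;
    in the second, h is replaced by d, another right inverse of kappa on its image up to the factor
    |b|. The two summands will supply the two J-parts of S_r. *)
Definition mono_iso b v :=
  if pivot b is Some i then kappa_at b (wedge_at i v) + d_at b (kappa_at b v) else v.

Definition mono_iso_inv b v :=
  if pivot b is Some i
  then scale_ext (mdeg b)%:R^-1 (kappa_at b (d_at b v) + wedge_at i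
    (kappa_at b v)) else v.

Lemma mono_isoD b v1 v2 : mono_iso b (v1 + v2) = mono_iso b v1 + mono_iso b v2.
Proof. by rewrite /mono_iso; case: pivot => [i|//];
  rewrite wedge_atD !kappa_atD d_atD addrACA. Qed.

Lemma mono_isoZ b c v : mono_iso b (scale_ext c v) = scale_ext c (mono_iso b v).
Proof. by rewrite /mono_iso; case: pivot => [i|//];
  rewrite wedge_atZ !kappa_atZ d_atZ scale_extD. Qed.

Lemma restrict_supp_mono_iso b v : restrict_supp b v = v ->
  restrict_supp b (mono_iso b v) = mono_iso b v.
Proof.
rewrite /mono_iso; case: pivotP => // i bi _ cv.
have cutD v1 v2 : restrict_supp b (v1 + v2) = restrict_supp b v1 + restrict_supp b v2.
  by apply/ffunP => s; rewrite !ffunE; case: ifP; rewrite ?addr0.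
by rewrite cutD restrict_supp_d_at !restrict_supp_kappa_at restrict_supp_wedge_at // cv.
Qed.

Lemma restrict_supp_mono_iso_inv b v : restrict_supp b v = v ->
  restrict_supp b (mono_iso_inv b v) = mono_iso_inv b v.
Proof.
rewrite /mono_iso_inv; case: pivotP => // i bi _ cv; apply: restrict_supp_id => s.
rewrite ffunE => /negP N; apply/negPn/negP => sb; apply: N; apply/eqP.
rewrite ffunE -{2}cv -{1}cv -restrict_supp_d_at -!restrict_supp_kappa_at
  -restrict_supp_wedge_at // !ffunE (negPf sb); ring.
Qed.

Lemma mdegR_neq0 b i : (0 < b i)%N -> (mdeg b)%:R != 0 :> R.
Proof. by move=> bi; rewrite pnatr_eq0 mdegE (bigD1 i)//=; lia. Qed.

(** Applying kappa leaves |b| kappa v = 0; then v = kappa h v, which is the value of the map. *)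
Lemma mono_iso_eq0 b v : mono_iso b v = 0 -> v = 0.
Proof.
rewrite /mono_iso; case: pivotP => // i bi _ pv0.
have kv0 : kappa_at b v = 0.
  have := kappa_atD b (kappa_at b (wedge_at i v)) (d_at b (kappa_at b v)).
  rewrite pv0 kappa_at0 kappa_atK add0r => k0.
  have := kappa_at_d_at b (kappa_at b v); rewrite kappa_atK d_at0 addr0 -k0 => /esym E.
  by rewrite -(scale_ext1 (kappa_at b v)) -(mulVf
    (mdegR_neq0 bi)) -scale_extA E scale_ext0.
by move: pv0; rewrite kv0 d_at0 addr0 => kh;
  rewrite -(kappa_at_wedge_at v bi) kv0 wedge_at0 kh addr0.
Qed.

Lemma mono_isoK b v : mono_iso b (mono_iso_inv b v) = v.
Proof.
rewrite /mono_iso /mono_iso_inv; case: pivotP => // i bi _; set N := (mdeg b)%:R.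
set x := scale_ext _ _.
have Nx : scale_ext N x = kappa_at b (d_at b v) + wedge_at i (kappa_at b v).
  by rewrite /x scale_extA mulfV ?scale_ext1//; exact: mdegR_neq0 bi.
have kNx : scale_ext N (kappa_at b x) = kappa_at b v.
  by rewrite -kappa_atZ Nx kappa_atD kappa_atK add0r -[RHS](kappa_at_wedge_at
    (kappa_at b v) bi) kappa_atK wedge_at0 addr0.
have N0 := mdegR_neq0 bi; rewrite -/N in N0.
suff E : scale_ext N (kappa_at b (wedge_at i x) + d_at b (kappa_at b x)) =
  scale_ext N v.
  by rewrite -[LHS]scale_ext1 -[RHS]scale_ext1 -(mulVf N0) -!scale_extA E.
rewrite scale_extD -kappa_atZ -wedge_atZ -d_atZ kNx -(kappa_at_d_at b v); congr (_ + _).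
(* The homotopy identity for |b| x identifies kappa h (|b| x) with kappa d v, because h kappa (|b|
   x) = h kappa v. *)
apply: (addIr (wedge_at i (kappa_at b (scale_ext N x)))).
by rewrite (kappa_at_wedge_at _ bi) kappa_atZ kNx Nx.
Qed.

Definition sum_lift D (f : 'X_{1..n} -> {ffun {set 'I_n} -> R}) : pform R n :=
  \sum_(b : 'X_{1..n < D}) lift_form b (f b).

Lemma component_sum_lift D f b :
  component b (sum_lift D f) = if (mdeg b < D)%N then restrict_supp b (f b) else 0.
Proof.
have mcompS := big_morph (component b) (@componentD R n b) (component0 R b).
rewrite /sum_lift mcompS; case: ifPn => bD.
  rewrite (bigD1 (BMultinom bD))//= component_lift eqxx big1 ?addr0// => b' bb'.
  by rewrite component_lift ifF//; apply: contraNF bb' => /eqP E; apply/eqP/val_inj.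
rewrite big1// => b' _; rewrite component_lift ifF//.
by apply: contraNF bD => /eqP ->; exact: bmdeg.
Qed.

End Glue.

(** * Membership in the space of shape functions *)

Section Membership.
Variables (R : realType) (n : nat).
Implicit Types (s t : {set 'I_n}) (i j : 'I_n) (w : pform R n).
Implicit Types (b m : 'X_{1..n}) (v : {ffun {set 'I_n} -> R}).

Lemma monomial_spanD (P : 'X_{1..n} -> {set 'I_n} -> Prop) w1 w2 :
  monomial_span P w1 -> monomial_span P w2 -> monomial_span P (w1 + w2).
Proof.
move=> H1 H2 s m; rewrite ffunE => /msuppD_le; rewrite mem_cat => /orP[/H1|/H2]; exact.
Qed.

Lemma monomial_span0 (P : 'X_{1..n} -> {set 'I_n} -> Prop) :
  monomial_span P (0 : pform R n).
Proof. by move=> s m; rewrite ffunE msupp0. Qed.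

Lemma JLD r (k : int) q1 q2 : @JL R n r k q1 -> JL r k q2 -> JL r k (q1 + q2).
Proof.
move=> [N1 [e1 [H1 ->]]] [N2 [e2 [H2 ->]]].
pose f N (e : nat -> pform R n) l := if (l <= N)%N then e l else 0.
exists (maxn N1 N2), (fun l => f N1 e1 l + f N2 e2 l); split.
  move=> l /andP[l1 _]; rewrite /f; split; apply: monomial_spanD.
  - case: ifP => lN; last exact: monomial_span0.
    by have [|] := H1 l; first by rewrite l1.
  - case: ifP => lN; last exact: monomial_span0.
    by have [|] := H2 l; first by rewrite l1.
  - case: ifP => lN; last exact: monomial_span0.
    by have [|] := H1 l; first by rewrite l1.
  - case: ifP => lN; last exact: monomial_span0.
    by have [|] := H2 l; first by rewrite l1.
have K N e M : (N <= M)%N ->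
    \sum_(1 <= l < N.+1) koszul (e l) = \sum_(1 <= l < M.+1) koszul (f N e l).
  move=> NM; rewrite (big_nat_widen 1 N.+1 M.+1) ?ltnS// big_mkcond /=.
  by apply: eq_bigr => l _; rewrite /f ltnS; case: ifP => // _; rewrite koszul0.
rewrite (K N1 e1 (maxn N1 N2)) ?leq_maxl// (K N2 e2 (maxn N1 N2)) ?leq_maxr//.
by rewrite -big_split; apply: eq_bigr => l _; rewrite (koszulD (f N1 e1 l)).
Qed.

Lemma JL0 r (k : int) : @JL R n r k 0.
Proof. by exists 0%N, (fun=> 0); split; [case|rewrite big_geq]. Qed.

Lemma SL0 r (k : int) : @SL R n r k 0.
Proof.
exists 0, 0, 0; split; [exact: monomial_span0|exact: JL0|exact: JL0|].
by rewrite ext_d0 !addr0.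
Qed.

Lemma SLD r (k : int) w1 w2 : SL r k w1 -> SL r k w2 -> SL r k (w1 + w2).
Proof.
move=> [p1 [q1 [f1 [Hp1 Hq1 Hf1 ->]]]] [p2 [q2 [f2 [Hp2 Hq2 Hf2 ->]]]].
exists (p1 + p2), (q1 + q2), (f1 + f2); split.
- exact: monomial_spanD.
- exact: JLD.
- exact: JLD.
rewrite (ext_dD f1 f2) addrACA; congr (_ + _); rewrite addrACA //.
Qed.

Lemma lift_msupp b v s m :
  m \in msupp (lift_form b v s) -> b = (m + mnm_set s)%MM /\ v s != 0.
Proof.
move=> /component_msupp; rewrite component_lift;
  case: (eqVneq (m + mnm_set s)%MM b) => [bE|_]; last by rewrite ffunE eqxx.
by rewrite ffunE; case: ifP => [_ vN|]; [split|rewrite eqxx].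
Qed.

Lemma lift_PL r k b v : (forall s, v s != 0 -> #|s| = k) -> (mdeg b <= r + k)%N ->
  PL r k%:Z (lift_form b v).
Proof.
move=> vk bk s m /lift_msupp[bE /vk sk]; split; first by rewrite sk.
by move: bk; rewrite bE mdegD mdeg_mnm_set sk leq_add2r.
Qed.

(** All terms have degree |b| - kk, so a single index l = |b| - S is needed: the weight bound S says
    that the linear degree is at least l, and S < |b| gives l >= 1. *)
Lemma lift_JL r kk S (k : int) b v : k + 1 = kk%:Z -> (r + kk = S.+1)%N ->
  (forall s, v s != 0 -> #|s| = kk /\ (wt b s <= S)%N) -> (S < mdeg b)%N ->
  JL r k (koszul (lift_form b v)).
Proof.
move=> kE rS vP Sb; pose l0 := (mdeg b - S)%N.
exists l0, (fun l => if l == l0 then lift_form b v else 0); split.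
  move=> l /andP[l1 ll]; case: eqP => [lE|_]; last by split; exact: monomial_span0.
  split=> s m /lift_msupp[bE /vP[sk wb]].
    split; first by rewrite kE sk.
    by move: Sb; rewrite lE /l0 bE mdegD mdeg_mnm_set sk; lia.
  have := wt_ldeg m s; rewrite -bE sk lE /l0.
  have : mdeg b = (mdeg m + kk)%N by rewrite bE mdegD mdeg_mnm_set sk.
  by move: wb => {vP}; lia.
rewrite big_nat_recr; last by rewrite /l0; lia.
rewrite /= eqxx big_nat big1 => [|l /andP[_ ll]]; last by rewrite ltn_eqF// koszul0.
exact/esym/add0r.
Qed.

(** Adding the pivot is free when b_i >= 2; when all b_j <= 1 the weight is at most #s anyway. *)
Lemma wt_pivot b i s S : (1 < b i)%N \/ (forall j, (b j <= 1)%N) -> i \in s ->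
  (wt b (s :\ i) <= S)%N -> (#|s| <= S)%N -> (wt b s <= S)%N.
Proof.
move=> [bi|b1] si ws sS; first by rewrite -(setD1K si) wtU1_big.
apply: leq_trans sS; rewrite -sum1_card [X in (_ <= X)%N]big_mkcond.
apply: leq_sum => j _; rewrite /wti ifF; last by rewrite ltnNge b1.
by case: (j \in s) => //; case: (_ == _).
Qed.

(** For |b| <= r + k everything is polynomial of degree at most r. Otherwise kappa h v lies in J_r
    and kappa v in J_(r+1), both with weight bound r + k. *)
Lemma lift_mono_iso_SL r k w b : (0 < r)%N -> fdeg k w -> wt_lt (r + k).+1 w ->
  SL r k%:Z (lift_form b (mono_iso b (component b w))).
Proof.
move=> r0 wk ww; set v := component b w.
have vk s : v s != 0 -> #|s| = k by move=> /wk.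
have vw s : v s != 0 -> (wt b s <= r + k)%N by move=> /ww.
have [bk|bk] := leqP (mdeg b) (r + k)%N.
  exists (lift_form b (mono_iso b v)), 0, 0; split;
    [|exact: JL0|exact: JL0|by rewrite ext_d0 !addr0].
  apply: lift_PL bk => s; rewrite /mono_iso; case: pivotP => [_|i bi _];
    first exact: vk.
  rewrite ffunE; have [->|/iota_ext_neq0[j [sj _ hN]] _] :=
    eqVneq (kappa_at b (wedge_at i v) s) 0.
    rewrite add0r => /eps_ext_neq0[j [sj _]] /iota_ext_neq0[j' [sj' _ /vk]].
    by rewrite cardsU1 sj' (cardsD1 j s) sj.
  move: hN => /eps_ext_neq0[j' [sj' _ /vk]].
  by have := cardsD1 j' (j |: s); rewrite sj' cardsU1 sj !add1n => -[<-].
rewrite /mono_iso; case: pivotP => [b0|i bi bP].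
  by rewrite b0 mdeg0 in bk.
exists 0, (lift_form b (kappa_at b (wedge_at i v))), (lift_form b (kappa_at b v));
  split.
- exact: monomial_span0.
- rewrite -koszul_lift; apply: (@lift_JL _ k.+1 (r + k)); rewrite ?addnS//;
  first by lia.
  move=> s /eps_ext_neq0[j [sj]]; case: (eqVneq j i) sj => [-> sj _|];
    last by rewrite eqxx.
  move=> vN; have sk : #|s| = k.+1 by rewrite (cardsD1 i s) sj (vk _ vN).
  by split=> //; apply: (wt_pivot bP sj (vw _ vN)); rewrite sk; lia.
- rewrite -koszul_lift; apply: (@lift_JL _ k (r + k)) => //; first by lia.
  by move=> s vs; rewrite (vk _ vs) (vw _ vs).
- by rewrite add0r ext_d_lift liftD.
Qed.

End Membership.

(** * Counting monomials *)

Section Counting.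
Local Open Scope nat_scope.
Variables (n r : nat).
Implicit Types (D s E : {set 'I_n}) (f g : {ffun 'I_n -> 'I_r.+1}) (i : 'I_n).

(** Stars and bars, after listing the exponents along [enum D]. *)
Lemma card_bounded_sum D M : (M <= r)%N ->
  #|[set g : {ffun 'I_n -> 'I_r.+1} |
      [forall i, (i \notin D) ==> (g i == 0 :> nat)] && (\sum_i g i <= M)%N]|
  = 'C(M + #|D|, #|D|).
Proof.
move=> Mr; rewrite addnC -(card_partial_ord_partitions #|D| M).
pose B := [set t : #|D|.-tuple 'I_M.+1 | \sum_(i <- t) i <= M]; rewrite -/B.
pose F (t : #|D|.-tuple 'I_M.+1) : {ffun 'I_n -> 'I_r.+1} :=
  [ffun i => inord (nth 0 (map val t) (index i (enum D)))].
have szE (t : #|D|.-tuple 'I_M.+1) : size (map val t) = size (enum D).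
  by rewrite size_map size_tuple cardE.
have ntM (t : #|D|.-tuple 'I_M.+1) j : (nth 0 (map val t) j <= M)%N.
  have [jt|jt] := ltnP j (size t); last by rewrite nth_default ?size_map.
  by rewrite (nth_map ord0)// -ltnS ltn_ord.
have FE t i : F t i = nth 0 (map val t) (index i (enum D)) :> nat.
  by rewrite ffunE inordK// ltnS (leq_trans (ntM _ _)).
have sumF t : \sum_i F t i = \sum_(x <- t) x.
  under eq_bigr do rewrite FE.
  rewrite (bigID (mem D))/= [X in _ + X]big1 ?addn0; last first.
    by move=> i iD; rewrite nth_default// szE leqNgt index_mem mem_enum.
  rewrite -big_enum -[RHS](big_map val xpredT id).
  have [i0 _|D0] := pickP (mem D); last first.
    have e0 : enum D = [::] by apply: size0nil; rewrite -cardE eq_card0.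
    by have := szE t; rewrite e0 => /size0nil ->; rewrite !big_nil.
  have sz2 : size (enum D) = size t by rewrite size_tuple cardE.
  rewrite (big_nth i0) [RHS](big_nth 0) size_map -sz2 !big_mkord; apply: eq_bigr => j _.
  by rewrite index_uniq ?enum_uniq.
rewrite -(@card_in_imset _ _ F (mem B)); last first.
  move=> t1 t2 _ _ /ffunP E; apply/val_inj/(inj_map val_inj)/(@eq_from_nth _ 0).
    by rewrite !szE.
  move=> j; rewrite szE => jt; have /card_gt0P[i0 _] :
    (0 < #|D|)%N by rewrite cardE; lia.
  have := congr1 val (E (nth i0 (enum D) j)).
  by rewrite /= !FE index_uniq ?enum_uniq.
apply: eq_card => g; rewrite inE; apply/andP/imsetP => [[/forallP g0 gM]|[t + ->]].
  pose t := [tuple of map (fun i => inord (g i) : 'I_M.+1) (enum D)].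
  have gi i : (g i <= M)%N by apply: leq_trans gM; rewrite (bigD1 i) ?leq_addr.
  have tE : map val (map (fun i => inord (g i) : 'I_M.+1) (enum D)) = map (fun i =>
    g i : nat) (enum D).
    by rewrite -map_comp; apply: eq_map => i /=; rewrite inordK// ltnS.
  have szt : size (map (fun i => inord (g i) : 'I_M.+1) (enum D)) == #|D|.
    by rewrite size_map cardE.
  have gF : g = F (Tuple szt).
    apply/ffunP => i; apply: val_inj; rewrite /= FE /= tE.
    have [iD|iD] := boolP (i \in D).
      by rewrite (nth_map i) ?index_mem ?mem_enum// nth_index ?mem_enum.
    rewrite nth_default; last by rewrite size_map leqNgt index_mem mem_enum.
    by have := g0 i; rewrite iD => /eqP.
  by exists (Tuple szt) => //; rewrite inE -sumF -gF.
rewrite inE -sumF => tM; split => //; apply/forallP => i; apply/implyP => iD.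
by rewrite FE nth_default// szE leqNgt index_mem mem_enum.
Qed.

Definition superlinear s f : {set 'I_n} := s :|: [set i | (1 < f i)%N].

(** Off D the exponents are freely 0 or 1, whence the power of 2. On D \ s they are at least 2;
    subtracting these 2's leaves arbitrary exponents on D of bounded sum. *)
Lemma card_superlinear D s : (0 < r)%N -> s \subset D ->
  #|[set f | (superlinear s f == D) && (\sum_(i in D) f i <= r)%N]| =
  if (2 * #|D :\: s| <= r)%N
  then (2 ^ (n - #|D|) * 'C(r - 2 * #|D :\: s| + #|D|, #|D|))%N else 0.
Proof.
move=> r0 sD; set c := #|D :\: s|.
have sum2 : \sum_(i in D) 2 * (i \notin s) = 2 * c.
  rewrite -big_distrr /= /c -sum1_card big_mkcond [X in _ = 2 * X]big_mkcond.
  congr (2 * _); apply: eq_bigr => i _; rewrite inE.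
  by case: (i \in s); case: (i \in D).
have f2 f i : superlinear s f = D -> i \in D -> i \notin s -> (1 < f i)%N.
  by move=> <-; rewrite !inE => /orP[->|].
case: ifPn => [cr|cr]; last first.
  apply/eqP; rewrite cards_eq0 -subset0; apply/subsetP => f; rewrite !inE.
  case/andP => /eqP fD fr; case/negP: cr; rewrite -sum2; apply: leq_trans fr.
  apply: leq_sum => i iD; case: (boolP (i \in s)) => [_|is_]; first by rewrite muln0.
  by rewrite muln1; exact: f2.
have -> : 2 ^ (n - #|D|) = #|powerset (~: D)|.
  rewrite card_powerset; congr (2 ^ _); have := cardsC D; rewrite card_ord.
  by move: #|D| #|~: D| => x y; lia.
rewrite -(@card_bounded_sum D (r - 2 * c)) ?leq_subr// mulnC -cardsX.
pose G := [set g : {ffun 'I_n -> 'I_r.+1} |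
  [forall i, (i \notin D) ==> (g i == 0 :> nat)] && (\sum_i g i <= r - 2 * c)].
rewrite -/G.
pose F (z : {ffun 'I_n -> 'I_r.+1} * {set 'I_n}) : {ffun 'I_n -> 'I_r.+1} :=
  [ffun i => inord (if i \in D then z.1 i + 2 * (i \notin s) else i \in z.2)].
have Gi g i : g \in G -> i \in D -> (g i + 2 * (i \notin s) <= r)%N.
  rewrite inE => /andP[_ gM] iD.
  have A : g i <= r - 2 * c by apply: leq_trans gM; rewrite (bigD1 i) ?leq_addr.
  have B : 2 * (i \notin s) <= 2 * c by rewrite -sum2 [X in _ <= X](bigD1 i)//=
    leq_addr.
  by apply: leq_trans (leq_add A B) _; rewrite subnK.
have FE g E i : g \in G ->
    F (g, E) i = (if i \in D then g i + 2 * (i \notin s) else i \in E) :> nat.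
  move=> gG; rewrite ffunE inordK//=; case: ifP => iD; first exact: Gi.
  by case: (i \in E).
have G0 g i : g \in G -> i \notin D -> g i = 0 :> nat.
  by rewrite inE => /andP[/forallP/(_ i) + _] iD; rewrite iD => /eqP.
rewrite -(@card_in_imset _ _ F (mem (setX G (powerset (~: D))))); last first.
  move=> [g1 E1] [g2 E2] /setXP[/= g1G E1D] /setXP[/= g2G E2D] /ffunP E12.
  have {}E12 i : F (g1, E1) i = F (g2, E2) i :> nat by rewrite E12.
  congr (_, _).
    apply/ffunP => i; apply: val_inj => /=; have [iD|iD] := boolP (i \in D).
      by have := E12 i; rewrite !FE// iD => /addIn.
    by rewrite !G0.
  apply/setP => i; have [iD|iD] := boolP (i \in D).
    move: E1D E2D; rewrite !inE => /subsetP E1D /subsetP E2D.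
    by apply/idP/idP => [/E1D|/E2D]; rewrite inE iD.
  by have := E12 i; rewrite !FE// (negPf iD); do 2 case: (_ \in _).
apply: eq_card => f; rewrite inE;
  apply/andP/imsetP => [[/eqP fD fr]|[[g E] /setXP[/= gG ED] ->]].
  pose g : {ffun 'I_n -> 'I_r.+1} :=
    [ffun i => inord (if i \in D then f i - 2 * (i \notin s) else 0)].
  have gE i : g i = (if i \in D then f i - 2 * (i \notin s) else 0) :> nat.
    by rewrite ffunE inordK// ltnS; case: ifP => // _; have := ltn_ord (f i); lia.
  have gfE i : i \in D -> g i + 2 * (i \notin s) = f i.
    move=> iD; rewrite gE iD; case: (boolP (i \in s)) => [_|is_] /=; first by lia.
    by have := f2 f i fD iD is_; lia.
  have gG : g \in G.
    rewrite inE; apply/andP; split.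
      by apply/forallP => i; apply/implyP => /negPf iD; rewrite gE iD.
    rewrite -(leq_add2r (2 * c)) subnK// -sum2; apply: leq_trans fr.
    rewrite (bigID (mem D))/= [X in _ + X + _]big1 ?addn0 => [|i /negPf iD];
      last by rewrite gE iD.
    by rewrite -big_split; apply: leq_sum => i iD; rewrite /= gfE.
  pose E := [set i | (i \notin D) && (f i == 1 :> nat)].
  exists (g, E).
    apply/setXP; split => //=; rewrite powersetE; apply/subsetP => i.
    by rewrite !inE => /andP[].
  apply/ffunP => i; apply: val_inj; rewrite /= FE//; case: ifPn => iD;
    first by rewrite gfE.
  rewrite inE iD /=; have : ~~ (1 < f i) by apply: contra iD;
    rewrite -fD !inE => ->; rewrite orbT.
  by case: (f i) => [[|[|]]].
split; last first.
  have -> : \sum_(i in D) F (g, E) i = \sum_(i in D) g i + 2 * c.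
    by rewrite -sum2 -big_split; apply: eq_bigr => i iD; rewrite FE// iD.
  apply: (@leq_trans (r - 2 * c + 2 * c)); last by rewrite subnK.
  rewrite leq_add2r; move: gG; rewrite inE => /andP[_]; apply: leq_trans.
  by rewrite [X in _ <= X](bigID (mem D)) leq_addr.
apply/eqP/setP => i; rewrite !inE FE//; case: (boolP (i \in s)) => [is_|is_] /=.
  by rewrite (subsetP sD).
case: (boolP (i \in D)) => iD; first by lia.
by case: (i \in E).
Qed.

(** The pairs are sorted by D = s U {i : m_i >= 2}, of size d, and then by s inside D. The upper end
    of the range of d expresses 2(d - k) <= r. *)
Lemma card_monomials (k : nat) : (0 < r)%N ->
  #|[set z : {ffun 'I_n -> 'I_r.+1} * {set 'I_n} | (#|z.2| == k) &&
      (\sum_i (if (i \in z.2) || (1 < z.1 i) then val (z.1 i) else 0) <= r)]| =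
  \sum_(k <= d < (minn n (r %/ 2 + k)).+1)
       2 ^ (n - d) * 'C(n, d) * 'C(r + 2 * k - d, d) * 'C(d, k).
Proof.
move=> r0; set S := [set z | _].
pose c d := if 2 * (d - k) <= r then 2 ^ (n - d) * 'C(r - 2 * (d - k) + d, d) else 0.
have -> : #|S| = \sum_(D : {set 'I_n}) \sum_(s : {set 'I_n} | (s \subset D) &&
  (#|s| == k)) c #|D|.
  rewrite -sum1_card (partition_big (fun z => superlinear z.2 z.1) predT)//=.
  apply: eq_bigr => D _.
  rewrite (partition_big (fun z => z.2) (fun s : {set 'I_n} =>
    (s \subset D) && (#|s| == k)))/=; last first.
    by move=> [f s] /= /andP[]; rewrite inE /= => /andP[-> _] /eqP <-; rewrite subsetUl.
  apply: eq_bigr => s /andP[sD /eqP sk].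
  have Ds : #|D :\: s| = #|D| - k by rewrite cardsD (setIidPr sD) sk.
  have := card_superlinear r0 sD; rewrite Ds -/(c #|D|) => <-.
  rewrite -sum1_card (reindex_onto (fun f => (f, s)) (fun z => z.1)) /=; last first.
    by move=> [f s'] /= /andP[_ /eqP <-].
  apply: eq_bigl => f; rewrite !inE /= !eqxx sk eqxx !andbT /=.
  rewrite andbC; apply: andb_id2l => /eqP fD; congr (_ <= _).
  rewrite [RHS]big_mkcond; apply: eq_bigr => i _; rewrite -fD !inE //.
have -> : \sum_(D : {set 'I_n}) \sum_(s : {set 'I_n} | (s \subset D) &&
  (#|s| == k)) c #|D|
    = \sum_(d < n.+1) 'C(n, d) * ('C(d, k) * c d).
  have H (D : {set 'I_n}) : \sum_(s : {set 'I_n} | (s \subset D) &&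
    (#|s| == k)) c #|D| = 'C(#|D|, k) * c #|D|.
    by rewrite sum_nat_const -cards_draws; congr (_ * _); apply: eq_card => s;
      rewrite !inE.
  under eq_bigr do rewrite H.
  have DL (D : {set 'I_n}) : #|D| < n.+1 by rewrite ltnS -[X in _ <= X]card_ord
    max_card.
  rewrite (partition_big (fun D : {set 'I_n} => Ordinal (DL D)) predT)//=.
  apply: eq_bigr => d _; have -> : 'C(n, d) = #|[set D : {set 'I_n} | #|D| == d]|.
    by rewrite card_draws card_ord.
  rewrite -sum_nat_const.
  apply: eq_big => [D|D /eqP <- //]; by rewrite inE -val_eqE.
rewrite -(big_mkord predT (fun d => 'C(n, d) * ('C(d, k) * c d))).
have [nk|kn] := ltnP n k.
  rewrite [RHS]big_geq; last by lia.
  by rewrite big_nat big1// => d /andP[_ dn]; rewrite (@bin_small d k) ?muln0//; lia.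
rewrite (@big_cat_nat _ _ _ k)//=; last by lia.
rewrite big_nat big1 ?add0n => [|d /andP[_ dk]];
  last by rewrite (@bin_small d k) ?muln0.
rewrite (@big_cat_nat _ _ _ (minn n (r %/ 2 + k)).+1)//=; [|by lia|by lia].
rewrite [X in _ + X]big_nat [X in _ + X]big1 ?addn0; last first.
  move=> d /andP[d1 d2]; rewrite /c ifF ?muln0//; apply/negbTE; rewrite -ltnNge; lia.
rewrite big_nat [RHS]big_nat; apply: eq_bigr => d /andP[d1 d2]; rewrite /c ifT;
  last by lia.
have -> : r - 2 * (d - k) + d = r + 2 * k - d by lia.
rewrite -[RHS]mulnA [2 ^ _ * 'C(n, d)]mulnC -[RHS]mulnA; congr (_ * _).
by rewrite mulnCA; congr (_ * _); rewrite mulnC.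
Qed.

End Counting.

(** * A basis of the shape functions *)

Section Basis.
Variables (R : realType) (n r k : nat).
Implicit Types (s t : {set 'I_n}) (i j : 'I_n) (w : pform R n).
Implicit Types (b m : 'X_{1..n}) (v : {ffun {set 'I_n} -> R}) (c : R).

(** The total degree exceeds the weight by the number of i off s with b_i = 1, hence by at most n;
    so all multidegrees that occur are below this bound. *)
Let D := ((r + k).+1 + n)%N.

(** If kappa v or kappa d v is nonzero, some set has bounded weight, which bounds |b|. If both
    vanish, the anticommutator gives |b| v = 0 and so |b| = 0. *)
Lemma shape_class_mdeg w b s : shape_class (r + k).+1 w -> component b w s != 0 ->
  (mdeg b < D)%N.
Proof.
move=> [K1 K2].
have E : kappa_at b (d_at b (component b w)) s + d_at b (kappa_at b
  (component b w)) s = (mdeg b)%:R * component b w s.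
  by have /ffunP/(_ s) := kappa_at_d_at b (component b w);
    rewrite [LHS]ffunE [RHS]ffunE.
have [[t wtt]|N] : {t | (wt b t < (r + k).+1)%N} +
    ((forall t, kappa_at b (component b w) t =
      0) /\ (forall t, kappa_at b (d_at b (component b w)) t = 0)).
  have [t|N1] := pickP (fun t => kappa_at b (component b w) t != 0).
    by rewrite /kappa_at -component_koszul => /K1; left; exists t.
  have [t|N2] := pickP (fun t => kappa_at b (d_at b (component b w)) t != 0).
    by rewrite /kappa_at /d_at -component_ext_d -component_koszul => /K2; left;
      exists t.
  by right; split=> t; apply/eqP; [move: (N1 t)|move: (N2 t)] => /negbFE.
  move=> _; rewrite -(wt_mdeg b t) /D.
  have := max_card (mem [set i | (i \notin t) && (b i == 1%N)]); rewrite card_ord.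
  by move: #|_| wtt => M; lia.
move=> vs; have [N1 N2] := N; move: E; rewrite N2 add0r.
have -> : kappa_at b (component b w) = 0 by apply/ffunP => t; rewrite N1 ffunE.
rewrite d_at0 ffunE => /esym/eqP; rewrite mulf_eq0 (negPf vs) orbF.
by rewrite pnatr_eq0 => /eqP ->.
Qed.

Definition shape_of w : pform R n := sum_lift D (fun b => mono_iso b (component b w)).
Definition shape_of_inv w : pform R n :=
  sum_lift D (fun b => mono_iso_inv b (component b w)).

Lemma component_shape_of b w :
  component b (shape_of w) = if (mdeg b < D)%N then mono_iso b (component b w) else 0.
Proof. by rewrite component_sum_lift (restrict_supp_mono_iso
  (restrict_supp_component b w)). Qed.

Lemma component_shape_of_inv b w :
  component b (shape_of_inv w) = if (mdeg b < D)%N then mono_iso_inv b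
    (component b w) else 0.
Proof. by rewrite component_sum_lift (restrict_supp_mono_iso_inv
  (restrict_supp_component b w)). Qed.

Lemma componentZ b c w : component b (c *: w) = scale_ext c (component b w).
Proof.
by apply/ffunP => s; rewrite !ffunE; case: ifP => _; rewrite ?mulr0// mcoeffZ.
Qed.

Lemma shape_ofD w1 w2 : shape_of (w1 + w2) = shape_of w1 + shape_of w2.
Proof.
apply: componentP => b; rewrite componentD !component_shape_of; case: ifP => _;
  last by rewrite addr0.
by rewrite (componentD b w1) mono_isoD.
Qed.

Lemma shape_ofZ c w : shape_of (c *: w) = c *: shape_of w.
Proof.
apply: componentP => b; rewrite componentZ !component_shape_of; case: ifP => _;
  last by rewrite scale_ext0.
by rewrite (componentZ b c w) mono_isoZ.
Qed.

Lemma shape_of0 : shape_of 0 = 0.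
Proof.
apply: componentP => b; rewrite component_shape_of !component0; case: ifP => // _.
by have := mono_isoZ b 0 (0 : {ffun {set 'I_n} -> R}); rewrite scale_ext0 => ->;
  apply/ffunP => s; rewrite !ffunE mul0r.
Qed.

Lemma shape_ofK w : shape_class (r + k).+1 w -> shape_of (shape_of_inv w) = w.
Proof.
move=> Aw; apply: componentP => b; rewrite component_shape_of component_shape_of_inv.
case: (ltnP (mdeg b) D) => bD; first exact: mono_isoK.
apply/ffunP => s; rewrite ffunE; apply/esym/eqP/negPn/negP => /(shape_class_mdeg Aw).
by rewrite ltnNge bD.
Qed.

Lemma shape_of_eq0 w : wt_lt (r + k).+1 w -> shape_of w = 0 -> w = 0.
Proof.
move=> ww P0; apply: componentP => b; rewrite component0.
have := component_shape_of b w; rewrite P0 component0;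
  case: ifPn => [_ /esym/mono_iso_eq0//|bD _].
apply/ffunP => s; rewrite [RHS]ffunE; apply/eqP/negPn/negP => /ww wb.
case/negP: bD; rewrite -(wt_mdeg b s) /D.
have := max_card (mem [set i | (i \notin s) && (b i == 1%N)]); rewrite card_ord.
by move: #|_| wb => M /=; lia.
Qed.

Hypothesis r_gt0 : (0 < r)%N.

(** The two summands of the inverse are kappa d v and the pivot wedged with kappa v: exactly what
    [shape_class] bounds. *)
Lemma mono_iso_inv_support w b s : fdeg k w -> shape_class (r + k).+1 w ->
  mono_iso_inv b (component b w) s != 0 -> #|s| = k /\ (wt b s <= r + k)%N.
Proof.
move=> wk [K1 K2]; rewrite /mono_iso_inv; case: pivotP => [b0 vs|i bi bP].
  split; first exact: wk vs.
  by have := wt_mdeg b s; rewrite b0 mdeg0; lia.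
rewrite ffunE mulf_eq0 negb_or => /andP[_].
rewrite ffunE; have [->|kN _] := eqVneq (kappa_at b (d_at b (component b w)) s) 0;
  last first.
  move: kN; rewrite /kappa_at /d_at -component_ext_d -component_koszul => kN.
  by split; [exact: (fdeg_koszul (fdeg_ext_d wk)) kN|exact: K2 kN].
rewrite add0r => /eps_ext_neq0[j [sj]]; case: (eqVneq j i) sj => [-> si _|];
  last by rewrite eqxx.
rewrite /kappa_at -component_koszul => kN.
have sk : #|s| = k.
  move: kN; rewrite component_koszul => /iota_ext_neq0[j' [sj' _ /wk]].
  by rewrite cardsU1 sj' (cardsD1 i s) si.
by split=> //; apply: (wt_pivot bP si (K1 _ _ kN)); rewrite sk; lia.
Qed.

Lemma shape_of_SL w : fdeg k w -> wt_lt (r + k).+1 w -> SL r k%:Z (shape_of w).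
Proof.
move=> wk ww; rewrite /shape_of /sum_lift; apply: (big_ind (fun w => SL r k%:Z w)).
- exact: SL0.
- exact: SLD.
- by move=> b _; exact: lift_mono_iso_SL.
Qed.

Lemma shape_of_inv_span w : fdeg k w -> shape_class (r + k).+1 w ->
  fdeg k (shape_of_inv w) /\ wt_lt (r + k).+1 (shape_of_inv w).
Proof.
move=> wk Aw; split=> b s; rewrite component_shape_of_inv; case: ifP => _;
  rewrite ?ffunE ?eqxx//.
  by move=> /(mono_iso_inv_support wk Aw)[].
by move=> /(mono_iso_inv_support wk Aw)[].
Qed.

(** The sum is the weight minus k, by [wt_superlinear]. Exponents up to r suffice for r >= 1: the
    counted ones are at most r, the others at most 1. *)
Definition mono_index :=
  [set z : {ffun 'I_n -> 'I_r.+1} * {set 'I_n} | (#|z.2| == k) &&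
    (\sum_i (if (i \in z.2) || (1 < z.1 i) then val (z.1 i) else 0) <= r)%N].

Definition mono_exp (f : {ffun 'I_n -> 'I_r.+1}) : 'X_{1..n} :=
  [multinom (f i : nat) | i < n].

Definition form_mono (z : {ffun 'I_n -> 'I_r.+1} * {set 'I_n}) : pform R n :=
  dx_term 'X_[mono_exp z.1] z.2.

Lemma mono_coef z s m :
  (form_mono z s)@_m = ((s == z.2) && (mono_exp z.1 == m))%:R.
Proof.
by rewrite ffunE; case: eqP => _ /=; [rewrite mcoeffX|rewrite mcoeff0].
Qed.

Lemma mono_exp_inj : injective mono_exp.
Proof.
move=> f g /mnmP E; apply/ffunP => i; apply: val_inj.
by have := E i; rewrite !mnmE.
Qed.

Lemma wt_superlinear m s : wt (m + mnm_set s) s =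
  (\sum_i (if (i \in s) || (1 < m i) then m i else 0) + #|s|)%N.
Proof.
rewrite -sum1_card [X in (_ + X)%N]big_mkcond -big_split /wt; apply: eq_bigr => i _.
rewrite mnmDE mnm_setE /wti; case: (i \in s) => /=; last by rewrite !addn0.
by rewrite !addn1; case: (m i).
Qed.

Lemma mono_index_span z : z \in mono_index ->
  fdeg k (form_mono z) /\ wt_lt (r + k).+1 (form_mono z).
Proof.
rewrite inE => /andP[/eqP zk zr].
have H s m : m \in msupp (form_mono z s) -> s = z.2 /\ m = mono_exp z.1.
  rewrite mcoeff_msupp mono_coef pnatr_eq0 eqb0 negbK.
  by move=> /andP[/eqP -> /eqP <-].
split; apply/spanned_msupp => s m /H[sE mE]; first by rewrite sE.
rewrite sE mE wt_superlinear zk ltnS leq_add2r; apply: leq_trans zr.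
by apply/eq_leq/eq_bigr => i _; rewrite mnmE.
Qed.

Lemma mono_expansion w : fdeg k w -> wt_lt (r + k).+1 w ->
  w = \sum_(z in mono_index) (w z.2)@_(mono_exp z.1) *: form_mono z.
Proof.
move=> wk ww; apply/ffunP => s; apply/mpolyP => m; rewrite sum_ffunE raddf_sum /=.
have zcoef z : (((w z.2)@_(mono_exp z.1) *: form_mono z) s)@_m =
    (w z.2)@_(mono_exp z.1) * ((s == z.2) && (mono_exp z.1 == m))%:R.
  by rewrite ffunE mcoeffZ mono_coef.
have [wm|wm] := eqVneq (w s)@_m 0.
  rewrite wm big1// => z _; rewrite zcoef.
  case: eqP => [<-|_]; last by rewrite mulr0.
  by case: eqP => [->|_]; rewrite ?wm ?mul0r ?mulr0.
have wm' : m \in msupp (w s) by rewrite mcoeff_msupp.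
have sk := wk _ _ (component_msupp wm'); have ws := ww _ _ (component_msupp wm').
have mr : (\sum_i (if (i \in s) || (1 < m i) then m i else 0) <= r)%N.
  by move: ws; rewrite /= wt_superlinear sk ltnS leq_add2r.
pose f : {ffun 'I_n -> 'I_r.+1} := [ffun i => inord (m i)].
have mf : mono_exp f = m.
  apply/mnmP => i; rewrite mnmE ffunE inordK// ltnS.
  have : ((if (i \in s) || (1 < m i) then m i else 0) <= r)%N.
    by apply: leq_trans mr; rewrite (bigD1 i) ?leq_addr.
  by case: ifP => // /negbT; rewrite negb_or -leqNgt => /andP[_]; lia.
have fS : (f, s) \in mono_index.
  rewrite inE /= sk eqxx; apply: leq_trans mr; apply/eq_leq/eq_bigr => i _.
  by rewrite -mf mnmE.
rewrite (bigD1 (f, s))//= zcoef /= mf !eqxx mulr1 big1 ?addr0// => z /andP[_ zN].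
rewrite zcoef; case: eqP => [sE|_]; last by rewrite mulr0.
case: eqP => [mE|_]; last by rewrite mulr0.
case/eqP: zN; rewrite (surjective_pairing z) -sE; congr (_, _).
by apply: mono_exp_inj; rewrite mE mf.
Qed.

Lemma mono_indep (c : {ffun 'I_n -> 'I_r.+1} * {set 'I_n} -> R) :
  \sum_(z in mono_index) c z *: form_mono z = 0 -> forall z, z \in mono_index ->
    c z = 0.
Proof.
move=> S0 z zS; have := congr1 (fun w : pform R n => (w z.2)@_(mono_exp z.1)) S0.
rewrite sum_ffunE raddf_sum /= ffunE mcoeff0 (bigD1 z)//= big1 ?addr0.
  by rewrite ffunE mcoeffZ mono_coef !eqxx mulr1.
move=> z' /andP[_ zz']; rewrite ffunE mcoeffZ mono_coef.
case: eqP => [sE|_]; last by rewrite mulr0.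
case: eqP => [/mono_exp_inj mE|_]; last by rewrite mulr0.
by case/eqP: zz'; rewrite (surjective_pairing z) (surjective_pairing z') sE mE.
Qed.

End Basis.

(** * Restriction to the box *)

Section Restriction.
Variables (R : realType) (n : nat) (a b : 'rV[R]_n).
Hypothesis a_lt_b : forall i, a ord0 i < b ord0 i.
Implicit Types (w : pform R n).

Lemma restrict_form_box w x s : box a b x ->
  restrict_form (box a b) w x s = (w s).@[x ord0].
Proof. by move=> bx; rewrite /restrict_form /patch ifT ?ffunE; last exact: mem_set. Qed.

Lemma restrict_form_nbox w x s : ~ box a b x -> restrict_form (box a b) w x s = 0.
Proof.
move=> nbx; rewrite /restrict_form /patch ifF ?ffunE//.
by apply/negP => /set_mem.
Qed.

Lemma restrict_form_linear c w1 w2 :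
  restrict_form (box a b) (c *: w1 + w2) =
  c *: restrict_form (box a b) w1 + restrict_form (box a b) w2.
Proof.
apply/funext => x; apply/ffunP => s; rewrite [RHS]ffunE [X in _ = X + _]ffunE.
have [bx|bx] := pselect (box a b x).
  by rewrite !restrict_form_box// 2!ffunE mevalD mevalZ.
by rewrite !restrict_form_nbox// scaler0 addr0.
Qed.

Lemma restrict_form0 : restrict_form (box a b) (0 : pform R n) = 0.
Proof.
by have := restrict_form_linear (-1) 0 0; rewrite scaleN1r oppr0 addr0 => ->;
  rewrite scaleN1r addNr.
Qed.

Lemma restrict_form_sum (I : finType) (P : pred I) (c : I -> R) (F : I -> pform R n) :
  restrict_form (box a b) (\sum_(i | P i) c i *: F i) =
  \sum_(i | P i) c i *: restrict_form (box a b) (F i).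
Proof.
elim/big_rec2: _ => [|i f w _ <-]; first exact: restrict_form0.
exact: restrict_form_linear.
Qed.

Lemma restrict_form_eq0 w : restrict_form (box a b) w = 0 -> w = 0.
Proof.
move=> w0; apply/ffunP => s; rewrite [RHS]ffunE; apply: (mpoly_eq0_box a_lt_b) => x bx.
by rewrite -(restrict_form_box _ _ bx) w0 /= ffunE.
Qed.

End Restriction.

Theorem theorem3p6 (R : realType) (n r k : nat) (a b : 'rV[R]_n)
    (n_ge1 : (1 <= n)%N) (r_ge1 : (1 <= r)%N) (k_le_n : (k <= n)%N)
    (a_lt_b : forall i, a ord0 i < b ord0 i) :
  has_dim (SL_on (box a b) r k)
    (\sum_(k <= d < (minn n (r %/ 2 + k)).+1)
       2 ^ (n - d) * 'C(n, d) * 'C(r + 2 * k - d, d) * 'C(d, k))%N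
  /\
  (forall mu : form_field R n, SL_on (box a b) r k mu ->
     (forall (d : nat) (f : face n) (nu : pform R n),
        (k <= d <= minn n (r %/ 2 + k))%N -> face_dim f = d ->
        PL_face f (r - 2 * (d - k))%N (d - k)%N nu ->
        dof a b f nu mu = 0) ->
     forall x, box a b x -> mu x = [ffun=> 0]).
Proof.
split; last first.
  move=> mu [w wS <-] dof0 x bx.
  (* The box as its own face; the trace on it is the identity. *)
  pose f := Face [set: 'I_n] [ffun=> false].
  have w0 : w = 0.
    rewrite -(ptrace_eq0 a_lt_b r_ge1 wS dof0 f); apply/ffunP => s.
    by rewrite ffunE /= subsetT substT.
  by apply/ffunP => s; rewrite restrict_form_box// w0 !ffunE meval0.
rewrite -(card_monomials n k r_ge1) -/(mono_index n r k).
pose T := box a b; pose S := mono_index n r k.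
pose E (z : {ffun 'I_n -> 'I_r.+1} * {set 'I_n}) :=
  restrict_form T (shape_of r k (form_mono R z)).
exists (fun i : 'I_#|S| => E (enum_val i)).
have sumE (c : {ffun 'I_n -> 'I_r.+1} * {set 'I_n} -> R) :
    \sum_(i < #|S|) c (enum_val i) *: E (enum_val i) =
    restrict_form T (shape_of r k (\sum_(z in S) c z *: form_mono R z)).
  rewrite -(big_enum_val (fun z => c z *: E z)) -restrict_form_sum; congr restrict_form.
  rewrite (big_morph _ (@shape_ofD R n r k) (@shape_of0 R n r k)).
  by apply: eq_bigr => z _; rewrite shape_ofZ.
have spanS (c : {ffun 'I_n -> 'I_r.+1} * {set 'I_n} -> R) :
    fdeg k (\sum_(z in S) c z *: form_mono R z) /\
    wt_lt (r + k).+1 (\sum_(z in S) c z *: form_mono R z).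
  have Z (Q : 'X_{1..n} -> {set 'I_n} -> Prop) (d : R) (w : pform R n) :
      spanned Q w -> spanned Q (d *: w).
    move=> H m s; rewrite componentZ ffunE mulf_eq0 negb_or => /andP[_]; exact: H.
  split; apply: spanned_sum => z zS; apply: Z; by have [] := mono_index_span R zS.
(* Coefficients numbered by ordinals are transported to the monomials themselves, with value 0 off
   [S]. *)
pose ext_c (c : 'I_#|S| -> R) z : R :=
  \sum_(i < #|S|) if enum_val i == z then c i else 0.
have ext_cE c i : ext_c c (enum_val i) = c i.
  rewrite /ext_c (bigD1 i)//= eqxx big1 ?addr0// => j ji.
  by case: eqP => // /enum_val_inj ij; rewrite ij eqxx in ji.
have sumEc (c : 'I_#|S| -> R) : \sum_i c i *: E (enum_val i) =
    restrict_form T (shape_of r k (\sum_(z in S) ext_c c z *: form_mono R z)).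
  by rewrite -sumE; apply: eq_bigr => i _; rewrite ext_cE.
split.
  move=> c; rewrite sumEc => /(restrict_form_eq0 a_lt_b) P0 i.
  have [_ W] := spanS (ext_c c).
  have Z := mono_indep (shape_of_eq0 W P0).
  by rewrite -(ext_cE c i); apply: Z; exact: enum_valP.
rewrite predeqE => mu; split.
  move=> [w wS <-].
  have wk := fdeg_SL wS.
  (* With all directions free no coordinate is frozen, so the base point 0 is arbitrary and the
     trace lemma speaks about [w] itself. *)
  have wA : shape_class (r + k).+1 w.
    have := shape_class_ptrace_SL [set: 'I_n] (fun=> 0) wS.
    suff -> : ptrace [set: 'I_n] (fun=> 0) w = w by [].
    by apply/ffunP => s; rewrite ffunE subsetT substT.
  have [Pk Pw] := shape_of_inv_span r_ge1 wk wA.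
  pose c (z : {ffun 'I_n -> 'I_r.+1} * {set 'I_n}) :=
    (shape_of_inv r k w z.2)@_(mono_exp z.1).
  exists (fun i : 'I_#|S| => c (enum_val i)) => //.
  rewrite sumE; congr restrict_form.
  by rewrite -(mono_expansion r_ge1 Pk Pw) shape_ofK.
move=> [c _ <-]; rewrite sumEc; have [Wk W] := spanS (ext_c c).
by exists (shape_of r k (\sum_(z in S) ext_c c z *: form_mono R z)) => //;
  exact: shape_of_SL.
Qed.
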